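(* Suppose $E$ is a directed graph in which every loop has an exit, and that $\{S_e,P_v\}$ and $\{T_e,Q_v\}$ are two Cuntz-Krieger $E$-families in which all the projections $P_v$ and $Q_v$ are non-zero. Then there is an isomorphism $\phi:C^*(\{S_e,P_v\})\to C^*(\{T_e,Q_v\})$ such that $\phi(S_e)=T_e$ for all $e\in E^1$ and $\phi(P_v)=Q_v$ for all $v\in E^0$.
   Context: A (directed) graph $E=(E^0,E^1,r,s)$ consists of countable sets $E^0$ of vertices and $E^1$ of edges, and maps $r,s:E^1\to E^0$ (range and source); $E$ is not assumed row-finite. A vertex $v$ is a sink if $|s^{-1}(v)|=0$ and an infinite-emitter if $|s^{-1}(v)|=\infty$; $v$ is singular if it is a sink or an infinite-emitter. A loop is a finite path $\alpha=\alpha_1\alpha_2\cdots\alpha_{|\alpha|}$ (edges with $r(\alpha_i)=s(\alpha_{i+1})$, length at least 1) with $s(\alpha)=r(\alpha)$. An exit for a loop $\alpha$ is an edge $f$ such that $s(f)=s(\alpha_i)$ for some $i$ and $f\ne\alpha_i$. A Cuntz-Krieger $E$-family consists of mutually orthogonal projections $\{P_v : v\in E^0\}$ and partial isometries $\{S_e : e\in E^1\}$ with orthogonal ranges (bounded operators on a Hilbert space) satisfying: (1) $S_e^*S_e=P_{r(e)}$ for every $e\in E^1$; (2) $S_eS_e^*\le P_{s(e)}$ for every $e\in E^1$; (3) $P_v=\sum_{\{e : s(e)=v\}}S_eS_e^*$ for every $v\in E^0$ that is not a singular vertex. $C^*(\{S_e,P_v\})$ denotes the $C^*$-algebra generated by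 the family. *)

(* Defs.v *)
From HB Require Import structures.
From mathcomp Require Import all_boot all_order all_algebra.
From mathcomp Require Import complex.
From mathcomp Require Import all_classical all_reals all_analysis.

Set Implicit Arguments.
Unset Strict Implicit.
Unset Printing Implicit Defensive.

Import Order.TTheory GRing.Theory Num.Theory.

Local Open Scope classical_set_scope.
Local Open Scope complex_scope.
Local Open Scope ring_scope.

Record graph := Graph {
  vertex : countType;
  edge : countType;
  rng : edge -> vertex;
  src : edge -> vertex
}.

Section Graphs.
Variable E : graph.

Definition emitted (v : vertex E) : set (edge E) := [set e | src e = v].

Definition sink (v : vertex E) : Prop := emitted v = set0.

Definition infinite_emitter (v : vertex E) : Prop := infinite_set (emitted v).

Definition singular (v : vertex E) : Prop := sink v \/ infinite_emitter v.

(* The nonempty path whose first edge is [e] and whose other edges are [p]. *)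
Definition is_path (e : edge E) (p : seq (edge E)) : Prop :=
  path (fun f g => rng f == src g) e p.

Definition is_loop (e : edge E) (p : seq (edge E)) : Prop :=
  is_path e p /\ src e = rng (last e p).

Definition is_exit (f : edge E) (a : seq (edge E)) : Prop :=
  exists2 g, g \in a & src f = src g /\ f <> g.

Definition every_loop_has_exit : Prop :=
  forall e p, is_loop e p -> exists f, is_exit f (e :: p).

End Graphs.

(* Complex Hilbert spaces: [inner] is linear in its first argument and
   conjugate-linear in the second, and induces the (complete) norm. *)
Record hilbert (R : realType) := Hilbert {
  hilbert_sort :> completeNormedModType R[i];
  inner : {dot hilbert_sort for Num.conj};
  normE_inner : forall x : hilbert_sort, `|x| ^+ 2 = inner x x
}.

Section Operators.
Variables (R : realType) (H : hilbert R).
Implicit Types (T : H -> H) (A : set (H -> H)).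

Definition bounded_operator T : Prop :=
  linear T /\ exists M : R, forall x : H, `|T x| <= M%:C * `|x|.

Definition opnorm T : R :=
  inf [set M : R | 0 <= M /\ forall x : H, `|T x| <= M%:C * `|x|].

(* For bounded [T] exactly one such operator exists, by the Riesz
   representation theorem; the default value is used for other [T] only. *)
Definition adjoint T : H -> H :=
  xget (fun=> 0) [set T' | forall x y : H, inner H (T x) y = inner H x (T' y)].

Definition is_projection T : Prop :=
  [/\ bounded_operator T, T \o T = T & adjoint T = T].

(* Isometric on the orthogonal complement of the kernel. *)
Definition is_partial_isometry T : Prop :=
  bounded_operator T /\
  forall x : H, (forall y : H, T y = 0 -> inner H x y = 0) -> `|T x| = `|x|.

Definition orthogonal_ranges T1 T2 : Prop :=
  forall x y : H, inner H (T1 x) (T2 y) = 0.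

(* [T2 - T1] is positive; in [R[i]], [0 <= z] says that [z] is real and
   nonnegative. *)
Definition operator_le T1 T2 : Prop :=
  forall x : H, 0 <= inner H ((T2 - T1) x) x.

(* Norm-closed *-subalgebras of B(H), not required to contain the identity. *)
Record is_cstar_subalgebra A : Prop := IsCstarSubalgebra {
  cstar_bounded : forall T, A T -> bounded_operator T;
  cstar_zero : A 0;
  cstar_add : forall T1 T2, A T1 -> A T2 -> A (T1 + T2);
  cstar_scale : forall (a : R[i]) T, A T -> A (a *: T);
  cstar_mul : forall T1 T2, A T1 -> A T2 -> A (T1 \o T2);
  cstar_adjoint : forall T, A T -> A (adjoint T);
  cstar_closed : forall T, bounded_operator T ->
    (forall eps : R, 0 < eps -> exists2 T', A T' & opnorm (T - T') < eps) -> A T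
}.

Definition cstar_generated (G : set (H -> H)) : set (H -> H) :=
  smallest is_cstar_subalgebra G.

End Operators.

(* [phi] restricts to an isomorphism of C*-algebras from [A] onto [B]; its
   values outside [A] are irrelevant. *)
Record is_cstar_isomorphism (R : realType) (H K : hilbert R)
    (A : set (H -> H)) (B : set (K -> K)) (phi : (H -> H) -> (K -> K)) : Prop :=
  IsCstarIsomorphism {
  iso_bij : set_bij A B phi;
  iso_add : forall T1 T2, A T1 -> A T2 -> phi (T1 + T2) = phi T1 + phi T2;
  iso_scale : forall (a : R[i]) T, A T -> phi (a *: T) = a *: phi T;
  iso_mul : forall T1 T2, A T1 -> A T2 -> phi (T1 \o T2) = phi T1 \o phi T2;
  iso_adjoint : forall T, A T -> phi (adjoint T) = adjoint (phi T)
}.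

Record is_CK_family (R : realType) (H : hilbert R) (E : graph)
    (S : edge E -> H -> H) (P : vertex E -> H -> H) : Prop := IsCKFamily {
  CK_projection : forall v, is_projection (P v);
  CK_projection_orth : forall v w, v <> w -> P v \o P w = 0;
  CK_partial_isometry : forall e, is_partial_isometry (S e);
  CK_ranges_orth : forall e f, e <> f -> orthogonal_ranges (S e) (S f);
  CK_source : forall e, adjoint (S e) \o S e = P (rng e);
  CK_range : forall e, operator_le (S e \o adjoint (S e)) (P (src e));
  CK_sum : forall v, ~ singular v ->
    P v = \sum_(e \in emitted v) (S e \o adjoint (S e))
}.

Definition CK_algebra (R : realType) (H : hilbert R) (E : graph)
    (S : edge E -> H -> H) (P : vertex E -> H -> H) : set (H -> H) :=
  cstar_generated (range S `|` range P).

(* Main.v *)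
Require Import Defs.
From HB Require Import structures.
From mathcomp Require Import all_boot all_order all_algebra.
From mathcomp Require Import complex.
From mathcomp Require Import all_classical all_reals all_analysis.
From mathcomp Require Import ring lra zify.

Set Implicit Arguments.
Unset Strict Implicit.
Unset Printing Implicit Defensive.

Import Order.TTheory GRing.Theory Num.Theory.
Import numFieldNormedType.Exports.

Local Open Scope ring_scope.

(** The relations of a Cuntz-Krieger family multiply two monomials
S_a P_v S_b*, where a and b are words of edges, to a monomial or to zero.
Finite formal combinations of triples (a, v, b) are therefore a common
symbolic *-algebra: [ev] evaluates them in every family, compatibly with
products ([ev_mulp]) and adjoints ([ev_adj]), and the values are dense in the
algebra of the family ([CK_algebraE]). So everything rests on
[norm_transfer]: a bound on the norm of the value of p in one family with
non-zero projections holds in every other one. Given it, approximating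
elements on both sides by the same p defines the isomorphism
([transfer_isomorphism]).

The proof of [norm_transfer] has three steps. Call |a| - |b| the degree of
(a, v, b) and let p_0 be the part of p of degree 0.

(1) [core_transfer]: if Re <p x, x> <= C |x|^2 for all x in the first family,
then Re <p_0 y, y> <= C |y|^2 for all y in the second. Let F be the finite set
of the edges that occur in p, and n a bound for the lengths of its words. In
the second space the projections Q_w decompose along the words over F that
start at w, each word being stopped at level n, or earlier on the part of its
range that no edge of F continues ([P_decomp]). This breaks the form of p_0 into
blocks indexed by a level k and a vertex v; a block is a finite scalar matrix,
indexed by the words of length k ending at v, tensored with an identity. In
the first space the same matrix is the compression of the whole of p to the
vectors S_s eta, |s| = k, provided that the terms of non-zero degree are
killed, that is, that eta is orthogonal to its translates along loops at v.
At the last level k = n this is automatic when there is no loop at v. Otherwise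
a loop at v has an exit, and the word that runs around the loop often enough and
then leaves by the exit is never a prefix of its translate along a loop of length
at most n ([exit_word]); vectors in the range of such a word are the required
eta. For k < n, vectors in the range of an edge from v outside F will do, or any
vector if v is a sink; when v has neither property, the relation for P_v makes
the block vanish ([gap_dichotomy]).

(2) Apply (1) to p* p. The form of its part of degree 0 at y is the sum of the
|p_d y|^2, where p_d is the part of p of degree d. If all degrees lie between
-N and N, a bound |p| <= c in the first family thus gives
|p|^2 <= (2N + 1) c^2 in the second ([norm_transfer_balanced]).

(3) Replace p by the powers (p* p)^(2^i): the degrees grow linearly with the
exponent, while norms are raised to that exponent because p* p is
self-adjoint. The factor 2N + 1 disappears in the limit ([power_trick]). *)

(** * Real-valued norms on complex Hilbert spaces *)

Section InnerProduct.
Variables (R : realType) (H : hilbert R).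
Implicit Types (x y z : H) (a : R[i]).
Local Notation ip := (inner H).
Local Notation Re := complex.Re.

Lemma ReD (a b : R[i]) : Re (a + b) = Re a + Re b.
Proof. by case: a; case: b. Qed.

Lemma ReN (a : R[i]) : Re (- a) = - Re a.
Proof. by case: a. Qed.

Lemma Re0 : Re (0 : R[i]) = 0.
Proof. by []. Qed.

Lemma Re_conj (a : R[i]) : Re a^* = Re a.
Proof. by case: a. Qed.

Lemma Re_sum (I : Type) (r : seq I) (P : pred I) (F : I -> R[i]) :
  Re (\sum_(i <- r | P i) F i) = \sum_(i <- r | P i) Re (F i).
Proof. exact: (big_morph _ ReD Re0). Qed.

Lemma Re_normr_ge0 (a : R[i]) : 0 <= Re `|a|.
Proof. by have := normr_ge0 a; rewrite lecE => /andP[_]. Qed.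

Lemma ReMr (t : R) (a : R[i]) : Re (t%:C%C * a) = t * Re a.
Proof. by case: a => u v /=; rewrite mul0r subr0. Qed.

Lemma ipDl x y z : ip (x + y) z = ip x z + ip y z.
Proof. exact: linearDl. Qed.
Lemma ipDr x y z : ip x (y + z) = ip x y + ip x z.
Proof. exact: linearDr. Qed.
Lemma ipZl a x y : ip (a *: x) y = a * ip x y.
Proof. exact: linearZl. Qed.
Lemma ipZr a x y : ip x (a *: y) = a^* * ip x y.
Proof. exact: linearZr. Qed.
Lemma ip0l x : ip 0 x = 0.
Proof. exact: linear0l. Qed.
Lemma ip0r x : ip x 0 = 0.
Proof. exact: linear0r. Qed.
Lemma ipNl x y : ip (- x) y = - ip x y.
Proof. exact: linearNl. Qed.
Lemma ipNr x y : ip x (- y) = - ip x y.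
Proof. exact: linearNr. Qed.
Lemma ipC x y : ip x y = (ip y x)^*.
Proof. by rewrite (hermC (inner H)) expr0 mul1r. Qed.
Lemma ip_suml (I : Type) (r : seq I) (P : pred I) (F : I -> H) y :
  ip (\sum_(i <- r | P i) F i) y = \sum_(i <- r | P i) ip (F i) y.
Proof. exact: (big_morph (ip^~ y) (fun u v => ipDl u v y) (ip0l y)). Qed.
Lemma ip_sumr (I : Type) (r : seq I) (P : pred I) (F : I -> H) x :
  ip x (\sum_(i <- r | P i) F i) = \sum_(i <- r | P i) ip x (F i).
Proof. exact: (big_morph (ip x) (ipDr x) (ip0r x)). Qed.

Definition nsq x : R := Re (ip x x).

Lemma nsqE x : ip x x = (nsq x)%:C%C.
Proof.
have := dnorm_ge0 (inner H) x; rewrite /nsq lecE => /andP[/eqP hi _].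
by case: (ip x x) hi => u v /= ->.
Qed.

Lemma nsq_ge0 x : 0 <= nsq x.
Proof. by have := dnorm_ge0 (inner H) x; rewrite /nsq lecE => /andP[_]. Qed.

Lemma nsq_eq0 x : nsq x = 0 -> x = 0.
Proof. by move=> h; apply/eqP; rewrite -(dnorm_eq0 (inner H)) nsqE h. Qed.

Lemma nsq0 : nsq 0 = 0.
Proof. by rewrite /nsq ip0l. Qed.

Lemma nsq_gt0 x : x <> 0 -> 0 < nsq x.
Proof.
move=> x0; rewrite lt_neqAle nsq_ge0 andbT eq_sym; apply/eqP => /nsq_eq0.
exact: x0.
Qed.

Lemma ip_eq x y : (forall z, ip x z = ip y z) -> x = y.
Proof.
move=> h; apply/eqP; rewrite -subr_eq0; apply/eqP/nsq_eq0.
by rewrite /nsq ipDl ipNl h subrr.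
Qed.

Lemma nsqN x : nsq (- x) = nsq x.
Proof. by rewrite /nsq ipNl ipNr opprK. Qed.

Lemma nsqD x y : nsq (x + y) = nsq x + nsq y + 2 * Re (ip x y).
Proof.
rewrite /nsq ipDl !ipDr !ReD (ipC y x) Re_conj; ring.
Qed.

Lemma nsqZ (t : R) x : nsq (t%:C%C *: x) = t ^+ 2 * nsq x.
Proof.
rewrite /nsq ipZl ipZr.
have -> : (t%:C%C)^* = t%:C%C :> R[i] by apply/eqP; rewrite eq_complex /= oppr0 !eqxx.
by rewrite !ReMr mulrA expr2.
Qed.

Lemma nsqB x y : nsq (x - y) = nsq x + nsq y - 2 * Re (ip x y).
Proof. by rewrite nsqD nsqN ipNr ReN mulrN. Qed.

Definition vnorm x : R := Re `|x|.

Lemma vnormE x : `|x| = (vnorm x)%:C%C :> R[i].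
Proof.
have := normr_ge0 x; rewrite /vnorm lecE => /andP[/eqP hi _].
by case: (`|x|) hi => u v /= ->.
Qed.

Lemma vnorm_ge0 x : 0 <= vnorm x.
Proof. by have := normr_ge0 x; rewrite /vnorm lecE => /andP[_]. Qed.

Lemma vnorm_sq x : vnorm x ^+ 2 = nsq x.
Proof.
have := normE_inner (h := H) x; rewrite vnormE nsqE -rmorphXn /=.
by move/complexI.
Qed.

Lemma vnorm_triangle x y : vnorm (x + y) <= vnorm x + vnorm y.
Proof.
have := ler_normD x y; rewrite !vnormE lecE => /andP[_]; by rewrite ReD.
Qed.

Lemma vnormN x : vnorm (- x) = vnorm x.
Proof. by rewrite /vnorm normrN. Qed.

Lemma vnormB x y : vnorm (x - y) <= vnorm x + vnorm y.
Proof. by rewrite -(vnormN y); exact: vnorm_triangle. Qed.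

Lemma vnorm0 : vnorm 0 = 0.
Proof. by rewrite /vnorm normr0. Qed.

Lemma vnorm_eq0 x : vnorm x = 0 -> x = 0.
Proof. by move=> h; apply: nsq_eq0; rewrite -vnorm_sq h expr0n. Qed.

Lemma vnormZ a x : vnorm (a *: x) = Re `|a| * vnorm x.
Proof.
rewrite /vnorm normrZ vnormE.
have := normr_ge0 a; rewrite lecE => /andP[/eqP hi _].
by case: (`|a|) hi => u v /= ->; rewrite mulr0 subr0.
Qed.

Lemma vnorm_le (c : R) x y : 0 <= c ->
  (vnorm x <= c * vnorm y) = (nsq x <= c ^+ 2 * nsq y).
Proof.
move=> c0; rewrite -!vnorm_sq -exprMn ler_sqr ?nnegrE ?vnorm_ge0 //.
by rewrite mulr_ge0 ?vnorm_ge0.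
Qed.

Lemma cauchy_schwarz x y : Re (ip x y) <= vnorm x * vnorm y.
Proof.
have h : vnorm (x + y) ^+ 2 <= (vnorm x + vnorm y) ^+ 2.
  by rewrite ler_sqr ?nnegrE ?addr_ge0 ?vnorm_ge0 // vnorm_triangle.
move: h; rewrite vnorm_sq nsqD -!vnorm_sq sqrrD; lra.
Qed.

(** By the Cauchy-Schwarz inequality between (1, ..., 1) and the norms. *)
Lemma nsq_sum (n : nat) (F : 'I_n -> H) :
  nsq (\sum_(i < n) F i) <= n%:R * \sum_(i < n) nsq (F i).
Proof.
elim: n F => [|n IH] F; first by rewrite !big_ord0 nsq0 mulr0.
rewrite !big_ord_recr /=.
set A := \sum_(i < n) F _.
set G := fun i : 'I_n => F (widen_ord (leqnSn n) i).
have hA := IH G; rewrite -/A in hA.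
set C := \sum_(i < n) nsq (G i) in hA; rewrite -[X in _ * (X + _)]/C.
have hB : 2 * Re (ip A (F ord_max)) <= C + n%:R * nsq (F ord_max).
  rewrite /A ip_suml Re_sum mulr_sumr.
  have -> : C + n%:R * nsq (F ord_max) = \sum_(i < n) (nsq (G i) + nsq (F ord_max)).
    by rewrite big_split /= sumr_const card_ord mulr_natl.
  apply: ler_sum => i _.
  by have := nsq_ge0 (G i - F ord_max); rewrite nsqB; lra.
rewrite nsqD -natr1 mulrDr !mulrDl !mul1r; lra.
Qed.

End InnerProduct.
Arguments nsq {R H} x.
Arguments vnorm {R H} x.

(** * Cuntz-Krieger relations with explicit adjoints *)

(** The form in which Cuntz-Krieger families are used: [cA e] is the adjoint of
[cS e], operators are bundled with their linearity, and the order and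
orthogonality conditions are replaced by the equations that they amount to. *)
Record ckrep (R : realType) (E : graph) (H : hilbert R) := CKRep {
  cS : edge E -> {linear H -> H};
  cA : edge E -> {linear H -> H};
  cP : vertex E -> {linear H -> H};
  ck_adj : forall e x y, inner H (cS e x) y = inner H x (cA e y);
  ck_sa : forall v x y, inner H (cP v x) y = inner H x (cP v y);
  ck_PP : forall v x, cP v (cP v x) = cP v x;
  ck_PP0 : forall v w x, v != w -> cP v (cP w x) = 0;
  ck_AS : forall e x, cA e (cS e x) = cP (rng e) x;
  ck_AS0 : forall e f x, e != f -> cA e (cS f x) = 0;
  ck_PS : forall e x, cP (src e) (cS e x) = cS e x;
  ck_SP : forall e x, cS e (cP (rng e) x) = cS e x;
  ck_sum : forall v (L : seq (edge E)) x, uniq L -> L != [::] ->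
    (forall e, (e \in L) = (src e == v)) ->
    cP v x = \sum_(e <- L) cS e (cA e x);
  ck_P0 : forall v, exists x, cP v x <> 0 }.

Section Walks.
Variable E : graph.
Implicit Types (u v w : vertex E) (s t : seq (edge E)).

(** Words of edges need not be paths. Unlike the chain of edges alone, [walk]
also makes sense for the empty word, which stays at its vertex. *)
Fixpoint walk u s w : bool :=
  if s is e :: s' then (src e == u) && walk (rng e) s' w else u == w.

(** The source of a word that ends at [w]; the default matters for the empty
word only. *)
Definition start s w := if s is e :: _ then src e else w.

Lemma walk_start u s w : walk u s w -> u = start s w.
Proof. by case: s => [|e s] /= => [/eqP //|/andP[/eqP]]. Qed.

Lemma walk_cat u s t w :
  walk u (s ++ t) w = walk u s (start t w) && walk (start t w) t w.
Proof.
elim: s u => [|e s IH] u /=; last by rewrite IH andbA.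
apply/idP/andP => [h|[/eqP -> //]].
by rewrite -(walk_start h) eqxx.
Qed.

End Walks.

Section Words.
Variables (R : realType) (E : graph) (H : hilbert R) (X : ckrep E H).
Local Notation S := (cS X).
Local Notation A := (cA X).
Local Notation P := (cP X).
Local Notation ip := (inner H).
Implicit Types (u v w : vertex E) (s t : seq (edge E)) (x y : H).

Lemma ck_AP e x : A e (P (src e) x) = A e x.
Proof.
by apply: ip_eq => z; rewrite ipC -ck_adj -ck_PS ck_sa ck_PP -ck_sa ck_PS ck_adj -ipC.
Qed.

Lemma ck_PA e x : P (rng e) (A e x) = A e x.
Proof. by apply: ip_eq => z; rewrite ck_sa ipC -ck_adj ck_SP ck_adj -ipC. Qed.

Lemma ck_PP_if v w x : P v (P w x) = if v == w then P w x else 0.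
Proof. by case: eqVneq => [->|?]; [exact: ck_PP|exact: ck_PP0]. Qed.

Lemma ck_PS_if v e x : P v (S e x) = if src e == v then S e x else 0.
Proof. by rewrite -(ck_PS X e) ck_PP_if eq_sym; case: eqP => // ->. Qed.

Lemma ck_AP_if v e x : A e (P v x) = if src e == v then A e x else 0.
Proof.
case: eqP => [<-|/eqP h]; first exact: ck_AP.
by rewrite -ck_AP ck_PP0 // linear0.
Qed.

(** [Aw s] is the adjoint of [Sw s]: it undoes the first edge first. *)
Fixpoint Sw s x : H := if s is e :: s' then S e (Sw s' x) else x.
Fixpoint Aw s x : H := if s is e :: s' then Aw s' (A e x) else x.

Lemma Sw_linear s : linear (Sw s).
Proof. by elim: s => [|e s IH] a x y //=; rewrite IH linearP. Qed.
HB.instance Definition _ s := GRing.isLinear.Build R[i] H H *:%R (Sw s) (Sw_linear s).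

Lemma Aw_linear s : linear (Aw s).
Proof. by elim: s => [|e s IH] a x y //=; rewrite linearP IH. Qed.
HB.instance Definition _ s := GRing.isLinear.Build R[i] H H *:%R (Aw s) (Aw_linear s).

Lemma Sw_cat s t x : Sw (s ++ t) x = Sw s (Sw t x).
Proof. by elim: s => //= e s ->. Qed.

Lemma Aw_cat s t x : Aw (s ++ t) x = Aw t (Aw s x).
Proof. by elim: s x => //= e s IH x; rewrite IH. Qed.

Lemma Sw_adj s x y : ip (Sw s x) y = ip x (Aw s y).
Proof. by elim: s y => //= e s IH y; rewrite ck_adj IH. Qed.

Lemma Aw_adj s x y : ip (Aw s x) y = ip x (Sw s y).
Proof. by rewrite ipC -Sw_adj -ipC. Qed.

(** Words that are not paths from [u] to [w] contribute zero, so monomials can be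
indexed by arbitrary words. *)
Lemma PSwP u s w x : P u (Sw s (P w x)) = if walk u s w then Sw s (P w x) else 0.
Proof.
elim: s u => [|e s IH] u /=; first by rewrite ck_PP_if; case: eqP => // ->.
rewrite ck_PS_if; case: eqP => //= _.
by rewrite -ck_SP IH; case: (walk _ _ _); rewrite ?linear0.
Qed.

Lemma PAwP u s w x : P w (Aw s (P u x)) = if walk u s w then P w (Aw s x) else 0.
Proof.
apply: ip_eq => z.
rewrite ck_sa Aw_adj ck_sa PSwP.
by case: (walk _ _ _); rewrite ?ip0r ?ip0l // ck_sa Aw_adj.
Qed.

Lemma Sw_start s w x : P (start s w) (Sw s (P w x)) = Sw s (P w x).
Proof. by case: s => [|e s] /=; rewrite ?ck_PP ?ck_PS. Qed.

End Words.

(** * Formal combinations of monomials *)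

Section Formal.
Variables (R : realType) (E : graph).

(** The triple [(a, v, b)] stands for the monomial S_a P_v S_b*. *)
Definition mono : Type := (seq (edge E) * vertex E * seq (edge E))%type.
Definition term : Type := (R[i] * mono)%type.
Implicit Types (m : mono) (p q : seq term).

Section Eval.
Variables (H : hilbert R) (X : ckrep E H).
Definition evm m (x : H) : H := Sw X m.1.1 (cP X m.1.2 (Aw X m.2 x)).
Definition ev p x : H := \sum_(m <- p) m.1 *: evm m.2 x.
End Eval.

(** The monomials, at most one, whose sum is P_v S_s* P_u S_t P_w. The vertex [u]
between the two words is what the recursion needs: cancelling S_e* S_e leaves
the projection at the range of e. *)
Fixpoint middle u v s t w : seq mono :=
  match s, t with
  | [::], _ => if (v == u) && walk u t w then [:: (t, w, [::])] else [::]
  | _, [::] => if (u == w) && walk u s v then [:: ([::], v, s)] else [::]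
  | e :: s', f :: t' =>
     if (e == f) && (src e == u) then middle (rng e) v s' t' w else [::]
  end.

Definition mulm m m' : seq mono :=
  [seq (m.1.1 ++ k.1.1, k.1.2, m'.2 ++ k.2)
     | k <- middle (start m'.1.1 m'.1.2) m.1.2 m.2 m'.1.1 m'.1.2].

Definition adjm m : mono := (m.2, m.1.2, m.1.1).

Definition adjp p : seq term := [seq (a.1^*, adjm a.2) | a <- p].
Definition scalep (c : R[i]) p : seq term := [seq (c * a.1, a.2) | a <- p].
Definition mul_term (a b : term) : seq term := [seq (a.1 * b.1, k) | k <- mulm a.2 b.2].
Definition mulp p q : seq term := flatten [seq mul_term a b | a <- p, b <- q].

Section EvalTheory.
Variables (H : hilbert R) (X : ckrep E H).
Implicit Types (x y z : H).
Local Notation ip := (inner H).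

Lemma evm_linear m : linear (evm X m).
Proof. by move=> a x y; rewrite /evm !linearP. Qed.
HB.instance Definition _ m :=
  GRing.isLinear.Build R[i] H H *:%R (evm X m) (evm_linear m).

Lemma ev_linear p : linear (ev X p).
Proof.
move=> a x y; rewrite /ev scaler_sumr -big_split /=.
by apply: eq_bigr => m _; rewrite linearP scalerDr !scalerA mulrC.
Qed.
HB.instance Definition _ p :=
  GRing.isLinear.Build R[i] H H *:%R (ev X p) (ev_linear p).

Lemma ev_nil x : ev X [::] x = 0.
Proof. by rewrite /ev big_nil. Qed.

Lemma ev_cat p q x : ev X (p ++ q) x = ev X p x + ev X q x.
Proof. by rewrite /ev big_cat. Qed.

Lemma ev_scale c p x : ev X (scalep c p) x = c *: ev X p x.
Proof.
by rewrite /ev big_map scaler_sumr; apply: eq_bigr => m _; rewrite scalerA.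
Qed.

Lemma ev_flatten (L : seq (seq term)) x :
  ev X (flatten L) x = \sum_(p <- L) ev X p x.
Proof. by elim: L => [|p L IH]; rewrite ?big_nil ?ev_nil // big_cons ev_cat IH. Qed.

Lemma evm_adj m x y : ip (evm X m x) y = ip x (evm X (adjm m) y).
Proof. by rewrite /evm /= Sw_adj ck_sa Aw_adj. Qed.

Lemma evm_adjm m x y : ip (evm X (adjm m) x) y = ip x (evm X m y).
Proof. by rewrite evm_adj; case: m => [[]]. Qed.

Lemma ev_adj p x y : ip (ev X p x) y = ip x (ev X (adjp p) y).
Proof.
rewrite /ev ip_suml ip_sumr big_map; apply: eq_bigr => m _.
by rewrite ipZl ipZr evm_adj conjCK.
Qed.

Lemma middleE u v s t w x :
  \sum_(k <- middle u v s t w) evm X k x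
    = cP X v (Aw X s (cP X u (Sw X t (cP X w x)))).
Proof.
elim: s u t => [|e s IH] u [|f t] /=.
- rewrite (ck_PP_if X v u); case: eqP => _ /=; last by rewrite big_nil.
  rewrite (ck_PP_if X u w); case: eqP => _ /=; last by rewrite big_nil.
  by rewrite big_seq1.
- rewrite ck_PP_if ck_PS_if; case: (eqVneq v u) => [_|]; last by rewrite big_nil.
  case: eqP => [e0|] /=; last by rewrite big_nil.
  rewrite -ck_SP PSwP.
  by case: (walk _ _ _) => /=; rewrite ?big_nil ?linear0 // big_seq1.
- rewrite (ck_PP_if X u w); case: eqP => [<-|_] /=; last by rewrite big_nil !linear0.
  rewrite ck_AP_if; case: (src e == u) => /=; last by rewrite big_nil !linear0.
  rewrite -(ck_PA X e x) PAwP.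
  by case: (walk _ _ _) => /=; rewrite ?big_nil // big_seq1.
- case: eqP => [->|/eqP ef] /=.
    rewrite ck_AP_if; case: (src f == u) => /=; last by rewrite big_nil !linear0.
    by rewrite IH ck_AS.
  rewrite big_nil ck_AP_if; case: (src e == u); rewrite ?linear0 //.
  by rewrite ck_AS0 // !linear0.
Qed.

Lemma mulmE m m' x :
  \sum_(k <- mulm m m') evm X k x = evm X m (evm X m' x).
Proof.
rewrite /mulm big_map {2 3}/evm.
rewrite -(Sw_start X m'.1.1 m'.1.2) -middleE linear_sum; apply: eq_bigr => k _.
by rewrite /evm /= Sw_cat Aw_cat.
Qed.

Lemma ev_mul_term a b x : ev X (mul_term a b) x = a.1 *: evm X a.2 (b.1 *: evm X b.2 x).
Proof.
rewrite /ev /mul_term big_map /= -scaler_sumr mulmE.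
by rewrite linearZ /= scalerA.
Qed.

Lemma ev_mulp p q x : ev X (mulp p q) x = ev X p (ev X q x).
Proof.
rewrite /mulp ev_flatten big_allpairs_dep {2}/ev; apply: eq_bigr => a _.
rewrite {2}/ev linear_sum scaler_sumr; apply: eq_bigr => b _; exact: ev_mul_term.
Qed.

End EvalTheory.

Lemma middle_size u v s t w :
  all (fun k : mono => size k.1.1 + size s == size k.2 + size t)%N (middle u v s t w).
Proof.
elim: s u t => [|e s IH] u [|f t] /=.
- by case: ifP => //= _; rewrite !eqxx.
- by case: ifP => //= _; rewrite addnC eqxx.
- by case: ifP => //= _; rewrite addnC eqxx.
- case: ifP => //= _; apply: sub_all (IH (rng e) t) => k /eqP h.
  by rewrite !addnS h.
Qed.

(** Degrees add up under multiplication, written without subtraction. *)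
Lemma mulm_size m m' :
  all (fun k : mono => size k.1.1 + size m.2 + size m'.2 ==
    size k.2 + size m.1.1 + size m'.1.1)%N (mulm m m').
Proof.
rewrite /mulm all_map; apply: sub_all (middle_size _ _ _ _ _) => k /eqP /= h.
by rewrite !size_cat; apply/eqP; lia.
Qed.

End Formal.

(** * Orthonormal coordinates for finitely many vectors *)

Section GramSchmidt.
Variables (R : realType) (H : hilbert R).
Local Notation ip := (inner H).

Lemma normalize (x : H) : x <> 0 ->
  exists c : R, nsq (c%:C%C *: x) = 1 /\ c * c * nsq x = 1.
Proof.
move=> /nsq_gt0 x0; exists (Num.sqrt (nsq x))^-1.
have h : (Num.sqrt (nsq x))^-1 ^+ 2 * nsq x = 1.
  by rewrite exprVn sqr_sqrtr ?nsq_ge0 // mulVf // gt_eqF.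
by rewrite nsqZ -expr2 h.
Qed.

(** The expansion of [x] is stated weakly, against every [z]. Requiring it of the
members of [es] too stands for orthonormality in the induction: the remainder
[r] of a new vector is then orthogonal to all the vectors met before. *)
Lemma gram_schmidt (xs : seq H) : exists es : seq H,
  forall x, x \in xs ++ es -> forall z,
    ip x z = \sum_(e <- es) ip x e * ip e z.
Proof.
elim: xs => [|x xs [es IH]]; first by exists [::].
pose r := x - \sum_(e <- es) ip x e *: e.
have hr y : y \in xs ++ es -> ip y r = 0.
  move=> yin; rewrite /r ipDr ipNr ip_sumr (IH y yin) -sumrB big1 // => e _.
  by rewrite ipZr -ipC mulrC subrr.
have hx z : ip x z = ip r z + \sum_(e <- es) ip x e * ip e z.
  rewrite -[in LHS](subrK (\sum_(e <- es) ip x e *: e) x) ipDl ip_suml.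
  by congr (_ + _); apply: eq_bigr => e _; rewrite ipZl.
have [r0|/eqP/normalize[c [_ c1]]] := eqVneq r 0.
  exists es => y; rewrite inE => /orP[/eqP->|/IH //] z.
  by rewrite hx r0 ip0l add0r.
have cJ : (c%:C%C)^* = c%:C%C :> R[i].
  by apply/eqP; rewrite eq_complex /= oppr0 !eqxx.
have hc : c%:C%C * c%:C%C * (nsq r)%:C%C = 1 :> R[i].
  by rewrite -!rmorphM /= c1.
exists (c%:C%C *: r :: es) => y yin z; rewrite big_cons ipZr ipZl cJ.
have: [|| y == x, y == c%:C%C *: r | y \in xs ++ es].
  by move: yin; rewrite /= inE !mem_cat inE [X in _ || X]orbCA.
case/or3P => [/eqP->|/eqP->|yin'].
- have -> : ip x r = (nsq r)%:C%C.
    rewrite hx -nsqE big_seq big1 ?addr0 // => e ein.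
    by rewrite hr ?mulr0 // mem_cat ein orbT.
  by rewrite hx; congr (_ + _); rewrite mulrACA mulrA hc mul1r.
- rewrite !ipZl big_seq big1 ?addr0 => [|e ein].
    by rewrite (nsqE r) [c%:C%C * (c%:C%C * _)]mulrA hc mul1r.
  by rewrite ipZl [ip r e]ipC hr ?conjC0 ?mulr0 ?mul0r // mem_cat ein orbT.
- by rewrite hr // mulr0 mul0r add0r IH.
Qed.

End GramSchmidt.

(** * Words over a finite alphabet *)

Section FWords.
Variables (T : eqType) (F : seq T).

Fixpoint words k : seq (seq T) :=
  if k is k'.+1 then [seq e :: s | e <- F, s <- words k'] else [:: [::]].

Lemma big_words0 (V : nmodType) (P : pred (seq T)) (f : seq T -> V) :
  \sum_(s <- words 0 | P s) f s = if P [::] then f [::] else 0.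
Proof. by rewrite big_mkcond big_seq1. Qed.

Lemma big_wordsS (V : nmodType) k (P : pred (seq T)) (f : seq T -> V) :
  \sum_(s <- words k.+1 | P s) f s
    = \sum_(e <- F) \sum_(s <- words k | P (e :: s)) f (e :: s).
Proof.
rewrite big_mkcond big_allpairs_dep; apply: eq_bigr => e _.
by rewrite [RHS]big_mkcond.
Qed.

Lemma mem_words k s : (s \in words k) = (size s == k) && all (mem F) s.
Proof.
elim: k s => [|k IH] [|e s] //=.
- by apply/negbTE/negP => /allpairsP[[? ?] [_ _]].
- apply/allpairsP/idP => [[[e' s'] /= [he hs [-> ->]]]|/andP[hs /andP[he ha]]].
    by move: hs; rewrite IH eqSS he.
  by exists (e, s); rewrite IH -eqSS hs.
Qed.

End FWords.

(** * Compression of all monomials by one vector *)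

Section SourceSide.
Variables (R : realType) (E : graph) (H : hilbert R) (X : ckrep E H).
Variables (F : seq (edge E)) (n k : nat) (v : vertex E) (eta : H).
Local Notation ip := (inner H).
Local Notation S := (cS X).
Local Notation A := (cA X).
Local Notation P := (cP X).

(** What makes the vectors S_s eta, for words s of length [k] ending at [v],
reproduce the block (k, v) of the degree 0 part and kill all other degrees. For
[k < n] the words of monomials can be longer than s, whence the third
condition. *)
Definition aperiodic_vector : Prop :=
  [/\ P v eta = eta, nsq eta = 1,
      (k < n)%N -> forall e, e \in F -> A e eta = 0
    & forall s, all (mem F) s -> (0 < size s <= n)%N -> ip (Sw X s eta) eta = 0].

Hypotheses (uF : uniq F) (kn : (k <= n)%N) (heta : aperiodic_vector).
Implicit Types (a b : seq (edge E) -> R[i]) (s t : seq (edge E)).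

Definition wvec i a : H := \sum_(s <- words F i) a s *: Sw X s eta.
(** Coefficients are supported by the words that are paths ending at [v]. *)
Definition wsupp a : Prop := forall s, ~~ walk (start s v) s v -> a s = 0.

Lemma wsupp_cat t a : wsupp a -> wsupp (fun s => a (t ++ s)).
Proof.
move=> ha s hs; apply: ha; apply: contra hs.
by rewrite walk_cat => /andP[].
Qed.

Lemma wvecS i a : wvec i.+1 a = \sum_(e <- F) S e (wvec i (fun s => a (e :: s))).
Proof.
rewrite /wvec big_wordsS; apply: eq_bigr => e _.
by rewrite linear_sum; apply: eq_bigr => s _; rewrite linearZ.
Qed.

Lemma wvec0 a : wvec 0 a = a [::] *: eta.
Proof. by rewrite /wvec big_seq1. Qed.

Lemma P_wvec w i a : P w (wvec i a) = wvec i (fun s => if walk w s v then a s else 0).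
Proof.
case: heta => Pe _ _ _.
rewrite /wvec linear_sum; apply: eq_bigr => s _.
by rewrite linearZ -Pe /= PSwP; case: walk; rewrite ?scaler0 ?scale0r.
Qed.

Lemma P_rng_wvec i a e : wsupp a ->
  P (rng e) (wvec i (fun s => a (e :: s))) = wvec i (fun s => a (e :: s)).
Proof.
move=> ha; rewrite P_wvec; apply: eq_bigr => s _; case: ifP => // h.
by rewrite ha //= eqxx h.
Qed.

Lemma A_wvecS e i a : e \in F -> wsupp a ->
  A e (wvec i.+1 a) = wvec i (fun s => a (e :: s)).
Proof.
move=> eF ha; rewrite wvecS linear_sum (bigD1_seq e) //= big1 ?addr0 => [|f fe].
  by rewrite ck_AS P_rng_wvec.
by rewrite ck_AS0 // eq_sym.
Qed.

(** On these vectors S_s* acts as a left shift of the coefficients. *)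
Lemma Aw_wvec s i a : all (mem F) s -> (size s <= i)%N -> wsupp a ->
  Aw X s (wvec i a) = wvec (i - size s) (fun t => a (s ++ t)).
Proof.
elim: s i a => [|e s IH] [|i] a //= /andP[eF sF] hs ha.
by rewrite A_wvecS // IH //; apply: (@wsupp_cat [:: e]).
Qed.

Lemma Aw_wvec_eq0 s a : all (mem F) s -> (k < size s)%N -> (k < n)%N ->
  wsupp a -> Aw X s (wvec k a) = 0.
Proof.
move=> + + kltn; case: heta => _ _ h _; move: h => /(_ kltn) h.
elim: (k) s a => [|i IH] [|e s] a //= /andP[eF sF] hs ha.
  by rewrite wvec0 linearZ /= h // scaler0 linear0.
by rewrite A_wvecS // IH //; apply: (@wsupp_cat [:: e]).
Qed.

Lemma ip_wvec0 i a b : (0 < i <= n)%N -> ip (wvec i a) (wvec 0 b) = 0.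
Proof.
case: heta => _ _ _ h hi.
rewrite wvec0 ipZr /wvec ip_suml big_seq big1 ?mulr0 // => s.
by rewrite mem_words => /andP[/eqP ss sF]; rewrite ipZl h ?mulr0 ?ss.
Qed.

(** Stripping the common first letters off two words of different lengths leaves
the empty word against a non-empty one, which aperiodicity makes
orthogonal. *)
Lemma ip_wvec i j a b : (i <= n)%N -> (j <= n)%N -> wsupp a -> wsupp b ->
  ip (wvec i a) (wvec j b)
    = if i == j then \sum_(s <- words F i) a s * (b s)^* else 0.
Proof.
elim: i j a b => [|i IH] [|j] a b hi hj ha hb.
- case: heta => _ n1 _ _.
  by rewrite !wvec0 ipZl ipZr nsqE n1 mulr1 big_seq1.
- by rewrite ipC ip_wvec0 ?conjC0.
- by rewrite ip_wvec0.
- rewrite {1}wvecS ip_suml big_wordsS eqSS.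
  rewrite big_seq [in RHS]big_seq.
  transitivity (\sum_(e <- F | e \in F)
     ip (wvec i (fun s => a (e :: s))) (wvec j (fun s => b (e :: s)))).
    by apply: eq_bigr => e eF; rewrite ck_adj A_wvecS.
  case: eqP => ij; last first.
    rewrite big1 // => e eF.
    rewrite IH ?(ltnW hi) ?(ltnW hj) //; try exact: (@wsupp_cat [:: e]).
    by case: eqP ij.
  apply: eq_bigr => e eF.
  rewrite IH ?(ltnW hi) ?(ltnW hj) //; try exact: (@wsupp_cat [:: e]).
  by rewrite ij eqxx.
Qed.

Lemma nsq_wvec i a : (i <= n)%N -> wsupp a ->
  nsq (wvec i a) = \sum_(s <- words F i) complex.Re (a s * (a s)^*).
Proof. by move=> hi ha; rewrite /nsq ip_wvec // eqxx Re_sum. Qed.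

(** Only monomials of degree 0 survive, and only through the words that extend
both of their words by the same tail. The right-hand side does not involve the
Hilbert space: it is the scalar block (k, v). *)
Lemma evm_wvec (m : mono E) a :
  all (mem F) m.1.1 -> all (mem F) m.2 -> (size m.1.1 <= n)%N -> (size m.2 <= n)%N ->
  wsupp a ->
  ip (evm X m (wvec k a)) (wvec k a)
    = if (size m.1.1 == size m.2) && (size m.1.1 <= k)%N then
        \sum_(s <- words F (k - size m.1.1) | walk m.1.2 s v)
           a (m.2 ++ s) * (a (m.1.1 ++ s))^*
      else 0.
Proof.
move=> F1 F2 s1 s2 ha; rewrite /evm Sw_adj.
have [h2|h2] := leqP (size m.2) k; last first.
  have kltn : (k < n)%N by exact: leq_trans h2 s2.
  rewrite Aw_wvec_eq0 // linear0 ip0l; case: ifP => // /andP[/eqP ->].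
  by rewrite leqNgt h2.
have [h1|h1] := leqP (size m.1.1) k; last first.
  have kltn : (k < n)%N by exact: leq_trans h1 s1.
  by rewrite [Aw X m.1.1 _]Aw_wvec_eq0 // ip0r andbF.
rewrite !Aw_wvec // P_wvec ip_wvec ?(leq_trans (leq_subr _ _) kn) //; first last.
- exact: (@wsupp_cat m.1.1).
- by move=> s hs; rewrite (@wsupp_cat m.2 a ha s hs) if_same.
rewrite andbT; case: (eqVneq (size m.1.1) (size m.2)) => [->|ne].
  rewrite eqxx [RHS]big_mkcond; apply: eq_bigr => s _.
  by case: ifP => //; rewrite mul0r.
case: eqP => // h; case/eqP: ne; lia.
Qed.

End SourceSide.

(** * Decomposition of the vertex projections along words *)

Section TargetSide.
Variables (R : realType) (E : graph) (K : hilbert R) (Y : ckrep E K).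
Variables (F : seq (edge E)) (V : seq (vertex E)) (n : nat).
Local Notation ip := (inner K).
Local Notation S := (cS Y).
Local Notation A := (cA Y).
Local Notation P := (cP Y).
Hypotheses (uF : uniq F) (uV : uniq V).
Hypothesis FV : forall e, e \in F -> (src e \in V) && (rng e \in V).

(** The projection onto the part of the range of P_v that is not continued by
edges of [F]; at the last level [n] words are not continued at all. *)
Definition gap k v (x : K) : K :=
  P v x - (if k == n then 0 else \sum_(e <- F | src e == v) S e (A e x)).

Definition component k v (s : seq (edge E)) (x : K) : K := gap k v (Aw Y s x).

Lemma gap_adj k v x y : ip (gap k v x) y = ip x (gap k v y).
Proof.
rewrite /gap; case: eqP => _; first by rewrite !subr0 ck_sa.
rewrite ipDl ipDr ipNl ipNr ck_sa ip_suml ip_sumr; congr (_ - _).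
by apply: eq_bigr => e _; rewrite ck_adj [RHS]ipC ck_adj -ipC.
Qed.

Lemma gap_P k v x : gap k v (P v x) = gap k v x.
Proof.
rewrite /gap ck_PP; case: eqP => // _; congr (_ - _).
by apply: eq_bigr => e /eqP <-; rewrite ck_AP.
Qed.

Lemma gap0 k v : gap k v 0 = 0.
Proof.
rewrite /gap linear0; case: eqP => _; rewrite ?subr0 // big1 ?subr0 // => e _.
by rewrite !linear0.
Qed.

Lemma gapK k v x : gap k v (gap k v x) = gap k v x.
Proof.
have PG : P v (gap k v x) = gap k v x.
  rewrite /gap linearB ck_PP /=; case: eqP => _; first by rewrite linear0.
  rewrite linear_sum; congr (_ - _).
  by apply: eq_bigr => e /eqP <-; rewrite ck_PS.
rewrite {1}/gap PG; case: eqP => [_|/eqP kn]; first by rewrite subr0.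
rewrite big_seq_cond big1 ?subr0 // => e /andP[eF /eqP ev].
rewrite /gap (negbTE kn) linearB linear_sum -big_filter.
have eF' : e \in [seq f <- F | src f == v] by rewrite mem_filter eF ev eqxx.
rewrite (bigD1_seq e) ?filter_uniq //= big1 => [|f fe].
  by rewrite ck_AS ck_PA addr0 -ev ck_AP subrr linear0.
by rewrite ck_AS0 // eq_sym.
Qed.

Lemma ip_gap k v x y : ip (gap k v x) (gap k v y) = ip (gap k v x) y.
Proof. by rewrite -gap_adj gapK. Qed.

Lemma component_supp k v s x : ~~ walk (start s v) s v -> component k v s x = 0.
Proof.
move=> h; rewrite /component -gap_P.
have -> : P v (Aw Y s x) = P v (Aw Y s (P (start s v) x)).
  by case: s {h} => [|e s] /=; rewrite ?ck_PP ?ck_AP.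
by rewrite PAwP (negbTE h) gap0.
Qed.

(** Iterate P_w = gap_w + sum of the S_e P_(r e) S_e* over the edges e of [F] from
w, until level [n] is reached. *)
Lemma P_decomp j w x y : (j <= n)%N -> w \in V ->
  ip (P w x) y = \sum_(j <= k < n.+1) \sum_(v <- V)
     \sum_(s <- words F (k - j) | walk w s v) ip (component k v s x) (component k v s y).
Proof.
have h0 i u a b : u \in V -> \sum_(v <- V) \sum_(s <- words F 0 | walk u s v)
    ip (component i v s a) (component i v s b) = ip (gap i u a) b.
  move=> uV'; rewrite (bigD1_seq u) //= (big_words0 F) /= eqxx /component /= ip_gap.
  by rewrite big1 ?addr0 // => v vu; rewrite (big_words0 F) /= eq_sym (negbTE vu).
move=> jn; move: {2}(n - j)%N (erefl (n - j)%N) => d; elim: d j jn w x y.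
  move=> j jn w x y dj wV; have {jn} -> : j = n by apply/eqP; rewrite eqn_leq jn -subn_eq0 dj.
  by rewrite big_nat1 subnn h0 // /gap eqxx subr0.
move=> d IH j jn w x y dj wV.
have jltn : (j < n)%N by rewrite -subn_gt0 dj.
rewrite big_ltn // subnn h0 // {1}/gap (ltn_eqF jltn) ipDl ipNl.
rewrite -[LHS]addr0 -addrA; congr (_ + _).
apply/eqP; rewrite eq_sym addrC subr_eq0; apply/eqP.
rewrite ip_suml.
transitivity (\sum_(e <- F | src e == w) \sum_(j.+1 <= k < n.+1) \sum_(v <- V)
    \sum_(s <- words F (k - j.+1) | walk (rng e) s v)
       ip (component k v s (A e x)) (component k v s (A e y))); last first.
  rewrite big_seq_cond [RHS]big_seq_cond; apply: eq_bigr => e /andP[eF _].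
  rewrite -IH //; last by case/andP: (FV eF).
    by rewrite ck_PA ck_adj.
  by rewrite subnS dj.
rewrite [RHS]exchange_big /= big_nat_cond [RHS]big_nat_cond.
apply: eq_bigr => k /andP[/andP[jk _] _].
rewrite [RHS]exchange_big /=; apply: eq_bigr => v _.
have -> : (k - j = (k - j.+1).+1)%N by rewrite subnSK.
rewrite big_wordsS [RHS]big_mkcond; apply: eq_bigr => e _ /=.
by case: (src e == w) => //=; rewrite big1.
Qed.

Lemma bessel x : \sum_(w <- V) nsq (P w x) <= nsq x.
Proof.
have := nsq_ge0 (x - \sum_(w <- V) P w x); rewrite nsqB.
have Pn w : complex.Re (ip x (P w x)) = nsq (P w x).
  by rewrite /nsq ck_sa ck_PP.
have -> : nsq (\sum_(w <- V) P w x) = \sum_(w <- V) nsq (P w x).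
  rewrite /nsq ip_suml Re_sum big_seq [RHS]big_seq; apply: eq_bigr => w wV.
  rewrite ck_sa linear_sum (bigD1_seq w) //= big1 ?addr0 => [|u uw].
    by rewrite -ck_sa.
  by rewrite ck_PP0 // eq_sym.
rewrite ip_sumr Re_sum (eq_bigr _ (fun w _ => Pn w)).
set a := \sum_(w <- V) _; lra.
Qed.

(** Summing the decomposition of every P_w, for w in [V], counts each component at
least once, namely from the start of its word. *)
Lemma component_bessel x : \sum_(0 <= k < n.+1) \sum_(v <- V)
     \sum_(s <- words F k) nsq (component k v s x) <= nsq x.
Proof.
apply: le_trans (bessel x).
have -> : \sum_(w <- V) nsq (P w x) = \sum_(w <- V) \sum_(0 <= k < n.+1) \sum_(v <- V)
     \sum_(s <- words F k | walk w s v) nsq (component k v s x).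
  rewrite big_seq [RHS]big_seq; apply: eq_bigr => w wV.
  rewrite /nsq ck_sa ck_PP -ck_sa (@P_decomp 0) // Re_sum; apply: eq_bigr => k _.
  rewrite subn0 Re_sum; apply: eq_bigr => v _; exact: Re_sum.
rewrite [leRHS]exchange_big /=; apply: ler_sum => k _.
rewrite [leRHS]exchange_big /= big_seq [leRHS]big_seq; apply: ler_sum => v vV.
under [leRHS]eq_bigr do rewrite big_mkcond.
rewrite [leRHS]exchange_big /= big_seq [leRHS]big_seq; apply: ler_sum => s.
rewrite mem_words => /andP[_ sF].
have nn w : 0 <= if walk w s v then nsq (component k v s x) else 0.
  by case: ifP => // _; exact: nsq_ge0.
have [h|h] := boolP (walk (start s v) s v); last first.
  by rewrite component_supp // nsq0 sumr_ge0 // => w _; case: ifP.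
have sV : start s v \in V.
  by case: (s) sF => [|e t] //= /andP[/FV/andP[]].
rewrite (bigD1_seq (start s v)) //= h lerDl sumr_ge0 //.
Qed.

End TargetSide.

(** * Transfer of the degree 0 part *)

Section Transfer.
Variables (R : realType) (E : graph) (H K : hilbert R).
Variables (X : ckrep E H) (Y : ckrep E K).
Variables (F : seq (edge E)) (V : seq (vertex E)) (n : nat).
Hypotheses (uF : uniq F) (uV : uniq V).
Hypothesis FV : forall e, e \in F -> (src e \in V) && (rng e \in V).
Hypothesis dich : forall k v, (k <= n)%N ->
  (exists eta, aperiodic_vector X F n k v eta) \/ (forall x, gap Y F n k v x = 0).

Definition supported (m : mono E) :=
  [&& all (mem F) m.1.1, all (mem F) m.2, (size m.1.1 <= n)%N,
      (size m.2 <= n)%N & m.1.2 \in V].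

Definition deg0 (a : term R E) := size a.2.1.1 == size a.2.2.

(** Block by block: the component vectors are expanded in an orthonormal system
[es], and each coordinate gives a family of scalars, hence a vector [w e] of the
other space whose form under the whole of [q] is that coordinate's share of the
block. *)
Lemma core_transfer (q : seq (term R E)) (C : R) :
  0 <= C -> all (fun a => supported a.2) q ->
  (forall x : H, complex.Re (inner H (ev X q x) x) <= C * nsq x) ->
  forall x : K, complex.Re (inner K (ev Y [seq a <- q | deg0 a] x) x) <= C * nsq x.
Proof.
move=> C0 qs hX x.
pose c k v s := component Y F n k v s x.
pose blk k v := \sum_(a <- q | deg0 a && (size a.2.1.1 <= k)%N)
   a.1 * \sum_(s <- words F (k - size a.2.1.1) | walk a.2.1.2 s v)
      inner K (c k v (a.2.2 ++ s)) (c k v (a.2.1.1 ++ s)).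
have -> : inner K (ev Y [seq a <- q | deg0 a] x) x
    = \sum_(0 <= k < n.+1) \sum_(v <- V) blk k v.
  rewrite /ev big_filter ip_suml.
  transitivity (\sum_(a <- q | deg0 a) \sum_(0 <= k < n.+1) \sum_(v <- V)
     if (size a.2.1.1 <= k)%N then a.1 *
       \sum_(s <- words F (k - size a.2.1.1) | walk a.2.1.2 s v)
        inner K (c k v (a.2.2 ++ s)) (c k v (a.2.1.1 ++ s)) else 0).
    move: qs; elim: (q) => [|a q' IH]; first by rewrite !big_nil.
    rewrite [LHS]big_cons [RHS]big_cons => /andP[/and5P[_ _ s1 _ wV] /IH ->].
    case: ifP => // d0; congr (_ + _).
    rewrite ipZl /evm Sw_adj (@P_decomp _ _ _ _ F V n uF uV FV (size a.2.1.1)) //.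
    rewrite mulr_sumr [RHS](big_cat_nat (n := size a.2.1.1)) //=; last exact: leqW.
    rewrite [X in _ = X + _](_ : _ = 0) ?add0r; last first.
      rewrite big_nat_cond big1 // => k /andP[/andP[_ kl] _].
      by rewrite big1 // => v _; rewrite leqNgt kl.
    rewrite big_nat_cond [RHS]big_nat_cond; apply: eq_bigr => k /andP[/andP[-> _] _].
    rewrite mulr_sumr; apply: eq_bigr => v _; congr (_ * _).
    by apply: eq_bigr => s _; rewrite /c /component !Aw_cat.
  rewrite exchange_big /=; apply: eq_bigr => k _.
  rewrite exchange_big /=; apply: eq_bigr => v _.
  by rewrite /blk -big_mkcondr.
rewrite Re_sum.
(* The inequality for a single block; the blocks then add up by Bessel. *)
have B k v : (k < n.+1)%N ->
    complex.Re (blk k v) <= C * \sum_(s <- words F k) nsq (c k v s).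
  rewrite ltnS => kn; case: (dich v kn) => [[eta heta]|hg]; last first.
    rewrite /blk big1 ?mulr_ge0 ?sumr_ge0 // => [s _|a _]; first exact: nsq_ge0.
    by rewrite big1 ?mulr0 // => s _; rewrite /c /component hg ip0l.
  have [es hes] := gram_schmidt [seq c k v s | s <- words F k].
  have {}hes s t : s \in words F k -> inner K (c k v s) (c k v t) =
      \sum_(e <- es) inner K (c k v s) e * (inner K (c k v t) e)^*.
    move=> sw; rewrite (hes (c k v s)) ?mem_cat ?map_f //.
    by apply: eq_bigr => e _; rewrite [in LHS](ipC e).
  pose a_ e s := inner K (c k v s) e.
  have asupp e : wsupp v (a_ e).
    by move=> s hs; rewrite /a_ /c component_supp // ip0l.
  pose w e := wvec X F eta k (a_ e).
  have -> : blk k v = \sum_(e <- es) inner H (ev X q (w e)) (w e).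
    have -> : \sum_(e <- es) inner H (ev X q (w e)) (w e) =
       \sum_(e <- es) \sum_(a <- q) a.1 * inner H (evm X a.2 (w e)) (w e).
      by apply: eq_bigr => e _; rewrite /ev ip_suml; apply: eq_bigr => a _; rewrite ipZl.
    rewrite exchange_big /= /blk.
    move: qs; elim: (q) => [|a q' IH]; first by rewrite !big_nil.
    rewrite [LHS]big_cons [RHS]big_cons => /andP[/and5P[F1 F2 s1 s2 wV] /IH ->].
    under [X in _ = X + _]eq_bigr => e _.
      rewrite (evm_wvec uF kn heta F1 F2 s1 s2 (asupp e)); over.
    rewrite -[X in _ = X + _]mulr_sumr.
    rewrite -/(deg0 a); case: ifP => hd; last by rewrite [X in _ * X]big1 // mulr0 add0r.
    congr (_ * _ + _); rewrite exchange_big /= big_seq_cond [RHS]big_seq_cond.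
    apply: eq_bigr => s; rewrite mem_words => /andP[/andP[/eqP ss sF] _].
    case/andP: hd => /eqP hd hk.
    by rewrite hes // mem_words all_cat F2 sF size_cat ss -hd subnKC // eqxx.
  rewrite Re_sum.
  apply: (@le_trans _ _ (\sum_(e <- es) C * nsq (w e))); first by apply: ler_sum.
  rewrite -mulr_sumr ler_wpM2l //.
  under eq_bigr do rewrite (nsq_wvec uF heta) //.
  rewrite exchange_big /= big_seq [leRHS]big_seq; apply: ler_sum => s sw.
  by rewrite /nsq hes // Re_sum.
apply: (@le_trans _ _ (C * \sum_(0 <= k < n.+1) \sum_(v <- V)
     \sum_(s <- words F k) nsq (c k v s))); last first.
  by rewrite ler_wpM2l // /c component_bessel.
rewrite mulr_sumr big_nat_cond [leRHS]big_nat_cond; apply: ler_sum => k /andP[/andP[_ kn] _].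
by rewrite Re_sum mulr_sumr; apply: ler_sum => v _; exact: B.
Qed.

End Transfer.

(** * Aperiodic vectors from exits of loops *)

Section Aperiodic.
Variable E : graph.
Implicit Types (u v w : vertex E) (s t : seq (edge E)).

Lemma walk_comp u s v t w : walk u s v -> walk v t w -> walk u (s ++ t) w.
Proof.
move=> hs ht; rewrite walk_cat -(walk_start ht) hs /=; exact: ht.
Qed.

Lemma walk_loop v e s : walk v (e :: s) v -> is_loop e s.
Proof.
rewrite /is_loop /is_path /= => /andP[/eqP <-].
have: forall w, walk (rng e) s w -> path (fun f g => rng f == src g) e s /\ w = rng (last e s).
  elim: s e => [|f s IH] e w /=; first by move/eqP.
  by move=> /andP[/eqP-> /IH]; rewrite eqxx.
by move=> h /h.
Qed.

Definition laps n r t := iter n (cat r) t.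

Lemma size_laps n r t : size (laps n r t) = (n * size r + size t)%N.
Proof. by elim: n => //= n IH; rewrite size_cat IH mulSn addnA. Qed.

Lemma laps_rcons n r t x : laps n r (rcons t x) = rcons (laps n r t) x.
Proof. by elim: n => //= n ->; rewrite rcons_cat. Qed.

Lemma walk_laps n v r t w : walk v r v -> walk v t w -> walk v (laps n r t) w.
Proof. by move=> hr ht; elim: n => //= n IH; apply: walk_comp hr IH. Qed.

Lemma nth_laps x0 n r i f j : (i < size r)%N -> (j < n * size r + i)%N ->
  nth x0 (laps n r (rcons (take i r) f)) j = nth x0 r (j %% size r).
Proof.
move=> ir; elim: n j => [|n IH] j /= hj.
  rewrite nth_rcons size_take ir hj nth_take // modn_small //.
  exact: ltn_trans hj ir.
rewrite nth_cat; case: ltnP => jr; first by rewrite modn_small.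
rewrite IH; last by rewrite -(ltn_add2r (size r)) subnK // addnAC [(_ * _ + _)%N]addnC -mulSn.
by rewrite -[in RHS](subnK jr) modnDr.
Qed.

(** The word [l] follows the loop [r] for [n + 1] turns, then up to its exit [f],
and takes the exit. Were it a prefix of [s ++ l], it would have period |s|, so
the letter |s| before the last would be [f]. The letter |r| before the last is
the letter [g] of the loop that [f] replaces, hence so would be the one
|r| + |s| before the last. But the part before the exit has period |r| and length
at least |r| + |s|, so [f] would equal [g]. *)
Lemma exit_word n v r : r != [::] -> walk v r v ->
  (exists f, is_exit f r) ->
  exists l w, walk v l w /\
    forall s, (0 < size s <= n)%N -> ~~ prefix l (s ++ l).
Proof.
move=> r0 hr [f [g gr [fg nfg]]].
pose i := index g r; pose l := laps n.+1 r (rcons (take i r) f).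
have ir : (i < size r)%N by rewrite index_mem.
have gi : nth f r i = g by rewrite nth_index.
exists l, (rng f); split.
  apply: walk_laps => //; move: hr; rewrite -{1}(cat_take_drop i r).
  rewrite (drop_nth f ir) gi walk_cat /= => /andP[h _].
  by rewrite -cats1; apply: walk_comp h _; rewrite /= fg !eqxx.
move=> s /andP[s0 sn]; apply/negP => /prefixP[t pt].
set M := (n.+1 * size r + i)%N.
have sizel : size l = M.+1 by rewrite size_laps size_rcons size_take ir addnS.
have per j : (j + size s <= M)%N -> nth f l (j + size s) = nth f l j.
  move=> hj; have := congr1 (fun z => nth f z (j + size s)) pt.
  rewrite /= !nth_cat sizel ltnS hj addnK ltnNge leq_addl /= => <-.
  by [].
have lM : nth f l M = f.
  rewrite /l laps_rcons nth_rcons size_laps (size_takel (ltnW ir)) -/M.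
  by rewrite ltnn eqxx.
have rM : (size r + size s <= n.+1 * size r)%N.
  rewrite mulSn leq_add2l; apply: leq_trans sn _; rewrite leq_pmulr //.
  exact: leq_trans ir.
have sM : (size r + size s <= M)%N by apply: leq_trans rM (leq_addr _ _).
have sizer : (0 < size r)%N by exact: leq_trans ir.
have e1 : nth f l (M - size s) = f.
  by rewrite -per subnK ?lM // (leq_trans _ sM) // leq_addl.
have e2 : nth f l (M - size r) = g.
  rewrite nth_laps //; last by rewrite -/M ltn_subrL sizer (leq_trans sizer) // (leq_trans _ sM) ?leq_addr.
  rewrite -gi; congr nth.
  by rewrite /M mulSn -addnA addKn modnMDl modn_small.
have e3 : nth f l (M - size r - size s) = g.
  by rewrite -per subnK ?e2 // ?leq_subr // leq_subRL // (leq_trans _ sM) ?leq_addr.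
have e4 : nth f l (M - size s) = nth f l (M - size r - size s).
  have M0 : (0 < M)%N by rewrite (leq_trans sizer) // (leq_trans _ sM) ?leq_addr.
  rewrite !nth_laps // -?/M; try lia.
  congr nth; rewrite -subnDA.
  have -> : (M - size s = (M - (size r + size s)) + size r)%N by lia.
  by rewrite modnDr.
by apply: nfg; rewrite -e1 e4 e3.
Qed.

Section Vectors.
Variables (R : realType) (H : hilbert R) (X : ckrep E H).
Local Notation ip := (inner H).

Lemma exists_unit_in v : exists x, cP X v x = x /\ nsq x = 1.
Proof.
have [x /normalize[c [c1 _]]] := ck_P0 X v.
by exists (c%:C%C *: cP X v x); rewrite linearZ /= ck_PP.
Qed.

Lemma nsq_Sw u s w x : walk u s w -> cP X w x = x -> nsq (Sw X s x) = nsq x.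
Proof.
elim: s u => [|e s IH] u //= /andP[_ hs] hx; rewrite -(IH _ hs hx).
rewrite /nsq ck_adj ck_AS; congr (complex.Re (ip _ _)).
by rewrite -hx PSwP hs.
Qed.

Lemma Aw_Sw_eq0 s t x : (size s <= size t)%N -> ~~ prefix s t ->
  Aw X s (Sw X t x) = 0.
Proof.
elim: s t => [|e s IH] [|f t] //=.
rewrite ltnS => st; case: eqP => [<-|/eqP ef] /= h.
  rewrite ck_AS; case: s IH st h => [|e' s] IH st h; first by rewrite prefix0s in h.
  rewrite /= ck_AP_if; case: ifP => _; last by rewrite linear0.
  exact: (IH t).
by rewrite ck_AS0 // linear0.
Qed.

(** P_v S_s P_v vanishes unless s is a loop at [v], so without such loops any unit
vector of the range of P_v will do. Otherwise take one in the range of S_l, for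
the word l of [exit_word]: as l is not a prefix of s l, S_l* S_s S_l = 0. *)
Lemma exists_aperiodic F n v : every_loop_has_exit E ->
  exists eta, aperiodic_vector X F n n v eta.
Proof.
move=> hE; rewrite /aperiodic_vector ltnn.
suff [eta [h1 h2 h3]] : exists eta, [/\ cP X v eta = eta, nsq eta = 1 &
    forall s, walk v s v -> (0 < size s <= n)%N -> ip (Sw X s eta) eta = 0].
  exists eta; split=> // s _ hs.
  rewrite -{2}h1 -ck_sa -h1 PSwP; case: ifP => // hw; rewrite ?ip0l //.
  by rewrite h1 h3.
have [[r [r0 hr]]|nl] := pselect (exists r, r != [::] /\ walk v r v); last first.
  have [x [x1 x2]] := exists_unit_in v; exists x; split=> // s hs s0.
  by exfalso; apply: nl; exists s; case: s s0 hs.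
have hex : exists f, is_exit f r.
  by case: r r0 hr => // e s _ /walk_loop/hE.
have [l [w [hl hp]]] := exit_word n r0 hr hex.
have [x [x1 x2]] := exists_unit_in w.
exists (Sw X l x); split.
- by rewrite -x1 PSwP hl.
- by rewrite (nsq_Sw hl x1).
- move=> s hs s0.
  rewrite ipC Sw_adj -Sw_cat Aw_Sw_eq0 ?ip0r ?conjC0 //; last exact: hp.
  by rewrite size_cat leq_addl.
Qed.

End Vectors.

(** The only point at which the relation for P_v at non-singular vertices enters:
if [v] emits edges, and all of them are in [F], then nothing is left over. In
all other cases the vertex leaves room for an aperiodic vector, and this depends
on the graph alone, not on the family. *)
Lemma gap_dichotomy (R : realType) (H K : hilbert R) (X : ckrep E H) (Y : ckrep E K)
    (F : seq (edge E)) n k v :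
  every_loop_has_exit E -> uniq F -> (k <= n)%N ->
  (exists eta, aperiodic_vector X F n k v eta) \/ (forall x, gap Y F n k v x = 0).
Proof.
move=> hE uF kn; have [->|/eqP kn'] := eqVneq k n.
  by left; exact: exists_aperiodic.
have {kn kn'} kn : (k < n)%N by rewrite ltn_neqAle kn andbT; exact/eqP.
have key eta : cP X v eta = eta -> nsq eta = 1 ->
    (forall e, e \in F -> cA X e eta = 0) -> aperiodic_vector X F n k v eta.
  move=> h1 h2 h3; split=> // -[|e s] //= /andP[eF _] _.
  by rewrite ck_adj h3 // ip0r.
have [[e [ev eF]]|allF] := pselect (exists e, src e = v /\ e \notin F).
  left; have [x [x1 x2]] := exists_unit_in X (rng e).
  exists (cS X e x); apply: key => [||f fF].
  - by rewrite -ev ck_PS.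
  - by rewrite (@nsq_Sw _ _ X v [:: e] (rng e)) //= ev !eqxx.
  - by rewrite ck_AS0 //; apply: contraNneq eF => <-.
have [[e ev]|sk] := pselect (exists e : edge E, src e = v); last first.
  left; have [x [x1 x2]] := exists_unit_in X v.
  exists x; apply: key => // e _.
  by rewrite -x1 ck_AP_if; case: eqP => // h; case: sk; exists e.
right=> x; rewrite /gap ltn_eqF //.
have memF f : src f = v -> f \in F.
  by move=> fv; apply: contrapT => /negP fF; apply: allF; exists f.
rewrite -big_filter -(@ck_sum _ _ _ Y v) ?subrr ?filter_uniq //.
- by apply/eqP => h; have := in_nil e; rewrite -h mem_filter ev eqxx memF.
- by move=> f; rewrite mem_filter; case: eqP => //= /memF ->.
Qed.

End Aperiodic.

(** * From a linear factor to none *)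

Section PowerTrick.
Variable R : realType.

Lemma bernoulli_le (s : R) n : 0 <= s -> 1 + n%:R * s <= (1 + s) ^+ n.
Proof.
move=> s0; elim: n => [|n IH]; first by rewrite mul0r addr0 expr0.
have n0 : 0 <= n%:R * s by rewrite mulr_ge0.
rewrite exprS -natr1; apply: le_trans (_ : (1 + s) * (1 + n%:R * s) <= _); last first.
  by rewrite ler_wpM2l // addr_ge0.
have := mulr_ge0 s0 n0; lra.
Qed.

(** If t = (1 + s) d with s > 0, then (1 + s)^(2 * 2^i) grows at least like
s^2 4^i, faster than the linear factor. *)
Lemma power_trick (t d M : R) : 0 <= t -> 0 <= d ->
  (forall i, t ^+ (2 ^ i.+1) <= (M * (2 ^ i)%:R + 1) * d ^+ (2 ^ i.+1)) -> t <= d.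
Proof.
move=> t0 d0 h; rewrite leNgt; apply/negP => dt.
have tp : 0 < t by exact: le_lt_trans dt.
have [d00|dn0] := eqVneq d 0.
  have := h 0%N; rewrite d00 expr0n /= mulr0 leNgt => /negP; apply.
  by rewrite exprn_gt0.
have dp : 0 < d by rewrite lt_neqAle eq_sym dn0.
pose s := t / d - 1.
have s0 : 0 < s by rewrite subr_gt0 ltr_pdivlMr // mul1r.
have ts : t = (1 + s) * d by rewrite /s addrC subrK divfK.
have b i : s ^+ 2 * i%:R <= M.
  have m0 : 0 < (2 ^ i)%:R :> R by rewrite ltr0n expn_gt0.
  have im : i%:R <= (2 ^ i)%:R :> R by rewrite ler_nat ltnW // ltn_expl.
  move: (h i); rewrite ts exprMn ler_pM2r ?exprn_gt0 //.
  rewrite expnSr exprM => hi.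
  have hb := bernoulli_le (2 ^ i) (ltW s0).
  have hsq : (1 + (2 ^ i)%:R * s) ^+ 2 <= ((1 + s) ^+ (2 ^ i)) ^+ 2.
    have p0 : 0 <= 1 + (2 ^ i)%:R * s by rewrite addr_ge0 // mulr_ge0 // ltW.
    by rewrite ler_sqr ?nnegrE // (le_trans p0).
  have {hi hb hsq} hi := le_trans hsq hi.
  apply: (@le_trans _ _ (s ^+ 2 * (2 ^ i)%:R)); first by rewrite ler_wpM2l // sqr_ge0.
  rewrite -(ler_pM2r m0); move: hi; set m := (2 ^ i)%:R.
  have := mulr_ge0 (ltW m0) (ltW s0); rewrite -/m => ms.
  move=> hi; have -> : s ^+ 2 * m * m = (1 + m * s) ^+ 2 - 1 - 2 * (m * s) by ring.
  lra.
have := b (Num.truncn (M / s ^+ 2)).+1.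
have := truncnS_gt (M / s ^+ 2).
have s20 : 0 < s ^+ 2 by rewrite exprn_gt0.
by rewrite ltr_pdivrMr // mulrC => h1 h2; have := lt_le_trans h1 h2; rewrite ltxx.
Qed.

End PowerTrick.

(** * Norm bounds up to the number of degrees *)

Section Isometry.
Variables (R : realType) (E : graph) (H K : hilbert R).
Variables (X : ckrep E H) (Y : ckrep E K).
Hypothesis hE : every_loop_has_exit E.
Implicit Types (p q : seq (term R E)).

Lemma exists_support p : exists F V n,
  [/\ uniq F, uniq V, forall e, e \in F -> (src e \in V) && (rng e \in V)
    & all (fun a : term R E => supported F V n a.2) p].
Proof.
suff [F [V [n hp]]] : exists F V n, all (fun a : term R E => supported F V n a.2) p.
  exists (undup F), (undup (V ++ map (@src E) F ++ map (@rng E) F)), n.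
  split; [exact: undup_uniq|exact: undup_uniq|move=> e|].
    rewrite !mem_undup !mem_cat => eF.
    by rewrite !(map_f (@src E)) ?(map_f (@rng E)) // !orbT.
  apply: sub_all hp => a /and5P[h1 h2 h3 h4 h5]; apply/and5P; split=> //.
  - by apply: sub_all h1 => e; rewrite /= mem_undup.
  - by apply: sub_all h2 => e; rewrite /= mem_undup.
  - by rewrite mem_undup mem_cat h5.
elim: p => [|[c [[s v] t]] p [F [V [n hp]]]]; first by exists [::], [::], 0%N.
exists (s ++ t ++ F), (v :: V), (size s + size t + n)%N; rewrite /=.
apply/andP; split.
  apply/and5P; split=> /=; rewrite ?mem_head //; try lia.
  - by apply/allP => e; rewrite /= mem_cat => ->.
  - by apply/allP => e; rewrite /= !mem_cat => ->; rewrite orbT.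
apply: sub_all hp => a /and5P[h1 h2 h3 h4 h5]; apply/and5P; split.
- by apply: sub_all h1 => e /= eF; rewrite !mem_cat eF !orbT.
- by apply: sub_all h2 => e /= eF; rewrite !mem_cat eF !orbT.
- exact: leq_trans h3 (leq_addl _ _).
- exact: leq_trans h4 (leq_addl _ _).
- by rewrite inE h5 orbT.
Qed.

Lemma deg0_transfer q (C : R) : 0 <= C ->
  (forall x : H, complex.Re (inner H (ev X q x) x) <= C * nsq x) ->
  forall x : K, complex.Re (inner K (ev Y [seq a <- q | deg0 a] x) x) <= C * nsq x.
Proof.
move=> C0; have [F [V [n [uF uV FV qs]]]] := exists_support q.
by apply: (core_transfer uF uV FV _ C0 qs) => k v kn; apply: gap_dichotomy.
Qed.

(** Degrees lie between [-N] and [N]. *)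
Definition balanced N (a : term R E) :=
  (size a.2.1.1 <= size a.2.2 + N)%N && (size a.2.2 <= size a.2.1.1 + N)%N.

(** The degree shifted by [N]; meaningful for [balanced] terms. *)
Definition degree N (a : term R E) : 'I_(N.*2).+1 := inord (size a.2.1.1 + N - size a.2.2).

Lemma degree_eq N a b : balanced N a -> balanced N b ->
  (degree N a == degree N b) = (size a.2.1.1 + size b.2.2 == size a.2.2 + size b.2.1.1)%N.
Proof.
case: a => [c [[s v] t]]; case: b => [c' [[s' v'] t']].
rewrite /balanced /degree /= => /andP[h1 h2] /andP[h3 h4].
by apply/eqP/eqP => [/(congr1 val)|h]; [rewrite /= !inordK|congr inord]; lia.
Qed.

Lemma filter_mul_term a b N : balanced N a -> balanced N b ->
  [seq k <- mul_term (a.1^*, adjm a.2) b | deg0 k]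
    = if degree N a == degree N b then mul_term (a.1^*, adjm a.2) b else [::].
Proof.
move=> ha hb; rewrite degree_eq // /mul_term.
have := mulm_size (adjm a.2) b.2.
elim: (mulm _ _) => [|k l IH] /=; first by case: ifP.
move=> /andP[/eqP hk /IH ->].
have -> : deg0 (a.1^* * b.1, k) = (size a.2.1.1 + size b.2.2 == size a.2.2 + size b.2.1.1)%N.
  by rewrite /deg0 /=; move: hk; rewrite /adjm /=; lia.
by case: eqP.
Qed.

Lemma balanced_adjp N p : all (balanced N) p -> all (balanced N) (adjp p).
Proof. by rewrite all_map; apply: sub_all => a /andP[h1 h2]; apply/andP. Qed.

Lemma balanced_mulp N M p q : all (balanced N) p -> all (balanced M) q ->
  all (balanced (N + M)) (mulp p q).
Proof.
move=> hp hq; rewrite /mulp; elim: p hp => //= a p IH /andP[ha hp].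
rewrite flatten_cat all_cat IH // andbT.
elim: q hq {IH} => //= b q IH /andP[hb /IH {}IH]; rewrite all_cat IH andbT.
rewrite all_map; apply: sub_all (mulm_size a.2 b.2) => k /eqP hk.
move: ha hb hk; case: a {IH} => [c [[s v] t]]; case: b => [c' [[s' v'] t']].
by case: k => [[s'' v''] t'']; rewrite /balanced /=; lia.
Qed.

Lemma exists_balanced p : exists N, all (balanced N) p.
Proof.
elim: p => [|a p [N IH]]; first by exists 0%N.
exists (size a.2.1.1 + size a.2.2 + N)%N; rewrite /= /balanced; apply/andP; split; first by lia.
by apply: sub_all IH => b /andP[h1 h2]; rewrite !addnA; apply/andP; split;
  [apply: leq_trans h1 _|apply: leq_trans h2 _]; lia.
Qed.

Lemma nsq_ev (L : hilbert R) (Z : ckrep E L) p x :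
  nsq (ev Z p x) = complex.Re (inner L (ev Z (mulp (adjp p) p) x) x).
Proof. by rewrite ev_mulp ipC -ev_adj -ipC. Qed.

Lemma ev_filter_mulp p q x :
  ev Y [seq a <- mulp p q | deg0 a] x
    = \sum_(a <- p) \sum_(b <- q) ev Y [seq k <- mul_term a b | deg0 k] x.
Proof. by rewrite /mulp filter_flatten ev_flatten big_map big_allpairs_dep. Qed.

(** A product of terms of p* and p has degree 0 exactly when the two terms of p
have the same degree. *)
Lemma deg0_square N p x : all (balanced N) p ->
  complex.Re (inner K (ev Y [seq a <- mulp (adjp p) p | deg0 a] x) x)
    = \sum_(i < N.*2.+1) nsq (\sum_(a <- p | degree N a == i) a.1 *: evm Y a.2 x).
Proof.
move=> bp.
have -> : inner K (ev Y [seq a <- mulp (adjp p) p | deg0 a] x) x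
   = \sum_(a <- p) \sum_(b <- p | degree N a == degree N b)
        inner K (b.1 *: evm Y b.2 x) (a.1 *: evm Y a.2 x).
  rewrite ev_filter_mulp big_map ip_suml big_seq [RHS]big_seq.
  apply: eq_bigr => a ap; rewrite ip_suml [RHS]big_mkcond big_seq [RHS]big_seq.
  apply: eq_bigr => b bp'; rewrite (@filter_mul_term _ _ N) ?(allP bp) //.
  case: ifP => _; last by rewrite ev_nil ip0l.
  by rewrite ev_mul_term /= ipZl ipZr evm_adjm.
transitivity (complex.Re (\sum_(i < N.*2.+1)
   inner K (\sum_(a <- p | degree N a == i) a.1 *: evm Y a.2 x)
           (\sum_(a <- p | degree N a == i) a.1 *: evm Y a.2 x))); last by rewrite Re_sum.
congr complex.Re.
under [RHS]eq_bigr do rewrite ip_sumr.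
rewrite [RHS](exchange_big_dep predT) //=; apply: eq_bigr => a _.
rewrite (big_pred1 (degree N a)) => [|i]; last by rewrite eq_sym.
by rewrite ip_suml; apply: eq_bigl => b; rewrite eq_sym.
Qed.

Lemma norm_transfer_balanced N p (C : R) : 0 <= C -> all (balanced N) p ->
  (forall x : H, nsq (ev X p x) <= C * nsq x) ->
  forall x : K, nsq (ev Y p x) <= N.*2.+1%:R * (C * nsq x).
Proof.
move=> C0 bp hX x.
have -> : ev Y p x = \sum_(i < N.*2.+1) \sum_(a <- p | degree N a == i) a.1 *: evm Y a.2 x.
  by rewrite /ev (partition_big (degree N) predT).
apply: le_trans (nsq_sum _) _; rewrite ler_wpM2l // -(deg0_square _ bp).
by apply: deg0_transfer => // y; rewrite -nsq_ev.
Qed.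

End Isometry.

(** * Norm bounds without loss *)

Section NormBounds.
Variables (R : realType) (E : graph) (L : hilbert R) (Z : ckrep E L).
Implicit Types (p q : seq (term R E)) (c d : R).

Definition opbound (T : L -> L) c := forall x, vnorm (T x) <= c * vnorm x.

Lemma opbound_adjp p c : 0 <= c -> opbound (ev Z p) c -> opbound (ev Z (adjp p)) c.
Proof.
move=> c0 hp x; set y := ev Z (adjp p) x.
have [y0|yn] := eqVneq (vnorm y) 0; first by rewrite y0 mulr_ge0 ?vnorm_ge0.
have yp : 0 < vnorm y by rewrite lt_neqAle eq_sym yn vnorm_ge0.
rewrite -(ler_pM2r yp) -expr2 vnorm_sq.
have -> : nsq y = complex.Re (inner L (ev Z p y) x).
  by rewrite ev_adj.
apply: le_trans (cauchy_schwarz _ _) _; rewrite mulrAC.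
by rewrite ler_wpM2r ?vnorm_ge0.
Qed.

Lemma opbound_mulp p q c d : 0 <= c ->
  opbound (ev Z p) c -> opbound (ev Z q) d -> opbound (ev Z (mulp p q)) (c * d).
Proof.
move=> c0 hp hq x; rewrite ev_mulp; apply: le_trans (hp _) _.
by rewrite -mulrA ler_wpM2l.
Qed.

(** The formal power of exponent 2^i of p* p. *)
Definition qpow p i := iter i (fun q => mulp q q) (mulp (adjp p) p).

Lemma opbound_qpow p i c : 0 <= c -> opbound (ev Z p) c ->
  opbound (ev Z (qpow p i)) (c ^+ (2 ^ i.+1)).
Proof.
move=> c0 hp; elim: i => [|i IH] /=.
  by rewrite expr2; apply: opbound_mulp => //; exact: opbound_adjp.
have -> : (2 ^ i.+2 = 2 ^ i.+1 + 2 ^ i.+1)%N by rewrite expnS mul2n addnn.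
by rewrite exprD; apply: opbound_mulp => //; rewrite exprn_ge0.
Qed.

Lemma qpow_sa p i x y : inner L (ev Z (qpow p i) x) y = inner L x (ev Z (qpow p i) y).
Proof.
elim: i x y => [|i IH] x y /=; last by rewrite !ev_mulp !IH.
by rewrite !ev_mulp -ev_adj ipC -ev_adj -ipC.
Qed.

Lemma balanced_qpow N p i : all (balanced N) p -> all (balanced (N * 2 ^ i.+1)) (qpow p i).
Proof.
move=> bp; elim: i => [|i IH] /=.
  by rewrite expn1 muln2 -addnn; apply: balanced_mulp => //; exact: balanced_adjp.
by rewrite expnS mulnCA mul2n -addnn; apply: balanced_mulp.
Qed.

(** For a self-adjoint G and a unit vector x, |G x|^2 = <G^2 x, x> <= |G^2 x|. *)
Lemma nsq_le_qpow p i x : nsq x = 1 ->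
  nsq (ev Z p x) ^+ (2 ^ i) <= vnorm (ev Z (qpow p i) x).
Proof.
move=> x1.
have hx : vnorm x = 1.
  by apply/eqP; rewrite -(eqrXn2 (n := 2)) ?vnorm_ge0 // vnorm_sq x1 expr1n.
elim: i => [|i IH].
  by rewrite expr1 nsq_ev; apply: le_trans (cauchy_schwarz _ _) _; rewrite hx mulr1.
rewrite expnSr exprM /=.
apply: (@le_trans _ _ (vnorm (ev Z (qpow p i) x) ^+ 2)).
  by rewrite ler_sqr ?nnegrE ?vnorm_ge0 // exprn_ge0 // nsq_ge0.
rewrite vnorm_sq /nsq -qpow_sa -ev_mulp.
by apply: le_trans (cauchy_schwarz _ _) _; rewrite hx mulr1.
Qed.

End NormBounds.

Lemma norm_transfer (R : realType) (E : graph) (H K : hilbert R)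
    (X : ckrep E H) (Y : ckrep E K) (p : seq (term R E)) (c : R) :
  every_loop_has_exit E -> 0 <= c -> opbound (ev X p) c -> opbound (ev Y p) c.
Proof.
move=> hE c0 hX x.
have [->|/eqP x0] := eqVneq x 0; first by rewrite linear0 !vnorm0 mulr0.
have [a [u1 ha]] := normalize x0; set u := a%:C%C *: x in u1.
have a0 : 0 < a ^+ 2.
  rewrite lt_neqAle sqr_ge0 andbT eq_sym; apply/eqP => a0.
  by move: ha; rewrite -expr2 a0 mul0r => /esym/eqP; rewrite oner_eq0.
have e1 : nsq u = a ^+ 2 * nsq x by rewrite nsqZ.
have e2 : nsq (ev Y p u) = a ^+ 2 * nsq (ev Y p x) by rewrite linearZ /= nsqZ.
rewrite vnorm_le // -(ler_pM2l a0) -e2 mulrCA -e1 u1 mulr1.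
have [N bp] := exists_balanced p.
apply: (@power_trick _ _ _ (4 * N%:R)); rewrite ?nsq_ge0 ?sqr_ge0 // => i.
apply: (@le_trans _ _ (nsq (ev Y (qpow p i) u))).
  rewrite -[leRHS]vnorm_sq expnSr exprM ler_sqr ?nnegrE ?vnorm_ge0 ?exprn_ge0 ?nsq_ge0 //.
  exact: nsq_le_qpow.
have hq : forall y : H, nsq (ev X (qpow p i) y) <= (c ^+ 2) ^+ (2 ^ i.+1) * nsq y.
  by move=> y; rewrite exprAC -vnorm_le ?exprn_ge0 //; exact: opbound_qpow.
have d0 : 0 <= (c ^+ 2) ^+ (2 ^ i.+1) by rewrite exprn_ge0 // sqr_ge0.
apply: le_trans (norm_transfer_balanced Y hE d0 (balanced_qpow i bp) hq u) _.
rewrite u1 mulr1.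
rewrite ler_wpM2r ?exprn_ge0 ?sqr_ge0 //.
rewrite -natr1 lerD2r -muln2 !natrM expnSr natrM; set z := (2 ^ i)%:R; lra.
Qed.

(** * Families of operators satisfy the relations *)

Section FromFamily.
Variables (R : realType) (E : graph) (H : hilbert R).
Local Notation ip := (inner H).

Definition is_adjoint (T T' : H -> H) := forall x y, ip (T x) y = ip x (T' y).

Lemma is_adjoint_unique T T1 T2 : is_adjoint T T1 -> is_adjoint T T2 -> T1 = T2.
Proof.
move=> h1 h2; apply/funext => y; apply: ip_eq => z.
by rewrite ipC -h1 h2 -ipC.
Qed.

Lemma adjointE T T' : is_adjoint T T' -> adjoint T = T'.
Proof.
move=> h; apply: (@is_adjoint_unique T) => //.
by rewrite /adjoint; case: xgetP => [T1 _ //|/(_ T')].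
Qed.

Lemma is_adjoint_linear T T' : is_adjoint T T' -> linear T'.
Proof.
move=> h a x y; apply: ip_eq => z.
rewrite ipC -h ipDr ipZr !h rmorphD rmorphM /= conjCK.
by rewrite -!ipC ipDl ipZl.
Qed.

(** As the default value of [adjoint] is zero, a non-zero value is a genuine
adjoint. Non-vanishing of the projections,
hence of the S_e* by S_e* S_e = P_(r e), provides all the adjoints that are
needed. *)
Lemma adjoint_neq0 T : adjoint T <> (fun=> 0) -> is_adjoint T (adjoint T).
Proof. by rewrite /adjoint; case: xgetP => [T1 _ //|]. Qed.

Lemma linear_pack (T : H -> H) : linear T -> exists f : {linear H -> H}, f = T :> (H -> H).
Proof.
move=> hT.
pose g := GRing.isLinear.Build R[i] H H *:%R T hT.
by exists (HB.pack_for {linear H -> H} T g).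
Qed.

(** S_e P_(r e) = S_e because |S_e x|^2 = <P_(r e) x, x>; and P_(s e) S_e = S_e
because S_e S_e* <= P_(s e) forces S_e* to vanish on the kernel of P_(s e). *)
Lemma CK_rep (S : edge E -> H -> H) (P : vertex E -> H -> H) :
  is_CK_family S P -> (forall v, P v <> 0) ->
  exists Z : ckrep E H, (forall e, cS Z e = S e :> (H -> H)) /\
    (forall v, cP Z v = P v :> (H -> H)).
Proof.
case=> hP hPo hS hSo hSs hSr hsum P0.
have Psa v : is_adjoint (P v) (P v).
  case: (hP v) => _ _ aP; rewrite -{2}aP; apply: adjoint_neq0; rewrite aP.
  exact: P0.
have Sad e : is_adjoint (S e) (adjoint (S e)).
  apply: adjoint_neq0 => h; apply: (P0 (rng e)).
  by rewrite -hSs h; apply/funext.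
have PP v x : P v (P v x) = P v x.
  by case: (hP v) => _ h _; rewrite -[in RHS]h.
have Slin e : linear (S e) by case: (hS e) => [[]].
have Plin v : linear (P v) by case: (hP v) => [[]].
have [S' hS'] := choice (fun e => linear_pack (Slin e)).
have [P' hP'] := choice (fun v => linear_pack (Plin v)).
have [A' hA'] := choice (fun e => linear_pack (is_adjoint_linear (Sad e))).
have adj e x y : ip (S' e x) y = ip x (A' e y) by rewrite hS' hA' Sad.
have sa v x y : ip (P' v x) y = ip x (P' v y) by rewrite hP' Psa.
have P'P v x : P' v (P' v x) = P' v x by rewrite hP' PP.
have P'P0 v w x : v != w -> P' v (P' w x) = 0.
  by move=> /eqP /hPo h; rewrite !hP'; exact: (congr1 (fun f => f x) h).
have AS e x : A' e (S' e x) = P' (rng e) x.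
  by rewrite hA' hS' hP' -hSs.
have AS0 e f x : e != f -> A' e (S' f x) = 0.
  move=> /eqP/hSo h; apply: ip_eq => z; rewrite ip0l ipC -adj.
  by rewrite !hS' h conjC0.
have SP e x : S' e (P' (rng e) x) = S' e x.
  apply/eqP; rewrite eq_sym -subr_eq0 -linearB; apply/eqP/nsq_eq0.
  by rewrite /nsq adj AS linearB /= P'P subrr ip0r.
have PS e x : P' (src e) (S' e x) = S' e x.
  have A0 y : A' e (y - P' (src e) y) = 0.
    set z := y - _; have Pz : P (src e) z = 0.
      by rewrite -hP' /z linearB /= P'P subrr.
    apply: nsq_eq0; apply/eqP; rewrite eq_le nsq_ge0 andbT.
    have := hSr e z; rewrite lecE => /andP[_].
    rewrite -[(_ - _) _]/(P (src e) z - S e (adjoint (S e) z)) Pz sub0r.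
    by rewrite ipNl ReN oppr_ge0 -hA' -hS' adj.
  apply: ip_eq => z; rewrite sa; apply/eqP; rewrite eq_sym -subr_eq0; apply/eqP.
  by rewrite -ipNr -ipDr adj A0 ip0r.
have sumE v (L : seq (edge E)) x : uniq L -> L != [::] ->
    (forall e, (e \in L) = (src e == v)) ->
    P' v x = \sum_(e <- L) S' e (A' e x).
  move=> uL L0 hL; have eL : emitted v = [set` L]%classic.
    by apply/seteqP; split=> e /=; rewrite hL => /eqP.
  rewrite hP' hsum; last first.
    case=> [s0|]; last by rewrite /infinite_emitter eL; apply; exact: finite_seq.
    case: L L0 uL hL eL => // e L _ _ hL _.
    have : emitted v e by apply/eqP; rewrite -hL mem_head.
    by rewrite s0.
  rewrite eL -fsbig_seq // fct_sumE.
  by apply: eq_bigr => e _; rewrite hS' hA'.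
have P'0 v : exists x, P' v x <> 0.
  apply: contrapT => h; apply: (P0 v); apply/funext => x.
  by apply: contrapT => hx; apply: h; exists x; rewrite hP'.
by exists (CKRep adj sa P'P P'P0 AS AS0 PS SP sumE P'0).
Qed.

End FromFamily.

(** * Limits and vanishing of small quantities *)

Section Limits.
Variables (R : realType) (H : hilbert R).
Local Notation ip := (inner H).

Definition inv1 n : R := n.+1%:R^-1.

Lemma inv1_gt0 n : 0 < inv1 n.
Proof. by rewrite invr_gt0 ltr0n. Qed.

Lemma inv1_le m n : (m <= n)%N -> inv1 n <= inv1 m.
Proof. by move=> mn; rewrite lef_pV2 ?posrE ?ltr0n // ler_nat. Qed.

Lemma inv1_small (e c : R) : 0 < e -> 0 <= c -> exists n, c * inv1 n < e.
Proof.
move=> e0 c0; exists (Num.truncn (c / e)).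
by rewrite /inv1 ltr_pdivrMr ?ltr0n // mulrC -ltr_pdivrMr // truncnS_gt.
Qed.

Lemma ler_small (a b c : R) : 0 <= c -> (forall e, 0 < e -> a <= b + e * c) -> a <= b.
Proof.
move=> c0 h; apply/ler_addgt0Pr => e e0.
have c1 : 0 < c + 1 by lra.
apply: le_trans (h (e / (c + 1)) _) _; first by rewrite divr_gt0.
rewrite lerD2l mulrAC ler_pdivrMr //; have := ltW e0; nra.
Qed.

Lemma vnorm_small (x : H) (c : R) :
  0 <= c -> (forall e, 0 < e -> vnorm x <= e * c) -> x = 0.
Proof.
move=> c0 h; apply: vnorm_eq0; apply/eqP; rewrite eq_le vnorm_ge0 andbT.
by apply: (ler_small c0) => e e0; rewrite add0r; exact: h.
Qed.

Lemma exists_limit (x : nat -> H) (c : R) : 0 <= c ->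
  (forall m n, vnorm (x m - x n) <= (inv1 m + inv1 n) * c) ->
  exists l, forall e N, 0 < e -> exists2 m, (N <= m)%N & vnorm (l - x m) < e.
Proof.
move=> c0 hx.
have hc : cauchy (x n @[n --> \oo])%classic.
  apply: cauchy_exP => eps; rewrite ltcE => /andP[/eqP i0 e0].
  have [N hN] := inv1_small e0 (mulr_ge0 (ler0n R 2) c0).
  exists (x N); exists N => // n /= Nn.
  rewrite /= -ball_normE /= vnormE ltcE /= i0 eqxx /=.
  apply: le_lt_trans (hx N n) _; apply: le_lt_trans hN.
  by have := ler_wpM2r c0 (inv1_le Nn); lra.
have [l hl] := (cvg_ex _).1 (cauchy_cvg _ hc).
exists l => e N e0.
have e0' : 0 < e%:C%C :> R[i] by rewrite ltcR.
have /cvgrPdist_lt/(_ _ e0')[M _ hM] := hl.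
exists (maxn N M); first exact: leq_maxl.
have := hM (maxn N M) (leq_maxr _ _).
by rewrite /= vnormE ltcR.
Qed.

Lemma norm_cauchy_schwarz x y : complex.Re `|ip x y| <= vnorm x * vnorm y.
Proof.
set c := ip x y.
have nc : `|c| = (complex.Re `|c|)%:C%C.
  have := normr_ge0 c; rewrite lecE => /andP[/eqP hi _].
  by case: (`|c|) hi => u v /= ->.
have r0 := Re_normr_ge0 c.
move: r0 nc; set r := complex.Re _ => r0 nc.
have [->|rn] := eqVneq r 0; first by rewrite mulr_ge0 ?vnorm_ge0.
have rp : 0 < r by rewrite lt_neqAle eq_sym rn.
have := cauchy_schwarz (c^* *: x) y.
rewrite ipZl -/c mulrC -normCK nc vnormZ norm_conjC -/r -rmorphXn /=.
by rewrite expr2 -mulrA ler_pM2l.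
Qed.

Lemma ip_small (z : R[i]) (c : R) :
  0 <= c -> (forall e, 0 < e -> complex.Re `|z| <= e * c) -> z = 0.
Proof.
move=> c0 h; apply/eqP; rewrite -normr_eq0 eq_le normr_ge0 andbT.
have := normr_ge0 z; rewrite !lecE => /andP[-> _] /=.
by apply: (ler_small c0) => e e0; rewrite add0r; exact: h.
Qed.

End Limits.

Section Opnorm.
Variables (R : realType) (H : hilbert R).
Implicit Types (T : H -> H).

Lemma opbound_normP T (M : R) : 0 <= M ->
  opbound T M <-> forall x : H, `|T x| <= M%:C%C * `|x|.
Proof.
move=> M0; split=> h x; have := h x.
  by rewrite !vnormE -rmorphM lecR.
by rewrite !vnormE -rmorphM lecR.
Qed.

Lemma opbound_le T (M N : R) : opbound T M -> M <= N -> opbound T N.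
Proof.
move=> h MN x; apply: le_trans (h x) _; by rewrite ler_wpM2r ?vnorm_ge0.
Qed.

Lemma opnorm_le T (M : R) : 0 <= M -> opbound T M -> opnorm T <= M.
Proof.
move=> M0 hT; apply: ge_inf; last by split=> //; apply/opbound_normP.
by exists 0 => ? [].
Qed.

Lemma opnorm_lt T (e : R) : bounded_operator T -> opnorm T < e ->
  exists2 M, 0 <= M < e & opbound T M.
Proof.
move=> [_ [M0 hM0]] /inf_lt[|M [m0 hM] Me].
  exists `|M0|; split=> // x; apply: le_trans (hM0 x) _.
  by rewrite ler_wpM2r // lecR ler_norm.
by exists M; [rewrite m0|apply/opbound_normP].
Qed.

Lemma bounded_operatorP T : bounded_operator T <->
  linear T /\ exists2 M : R, 0 <= M & opbound T M.
Proof.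
split=> -[hl]; last first.
  by move=> [M M0 /(opbound_normP _ M0) h]; split=> //; exists M.
move=> [M0 hM0]; split=> //; exists `|M0| => //.
apply/opbound_normP => // x; apply: le_trans (hM0 x) _.
by rewrite ler_wpM2r // lecR ler_norm.
Qed.

End Opnorm.

(** * The norm closure of the values of formal combinations *)

Section Closure.
Variables (R : realType) (E : graph) (H : hilbert R) (X : ckrep E H).
Implicit Types (p q : seq (term R E)) (A B : H -> H).

Definition subp p q : seq (term R E) := p ++ scalep (-1) q.

Lemma ev_subp p q x : ev X (subp p q) x = ev X p x - ev X q x.
Proof. by rewrite ev_cat ev_scale scaleN1r. Qed.

Lemma ev_adjp_subp p q x :
  ev X (adjp (subp p q)) x = ev X (adjp p) x - ev X (adjp q) x.
Proof.
apply: ip_eq => z; rewrite ipC -ev_adj ev_subp ipDl ipNl rmorphB /=.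
by rewrite ipDl ipNl (ipC (ev X (adjp p) x)) (ipC (ev X (adjp q) x)) -!ev_adj.
Qed.

Definition approx A p (e : R) := opbound (fun x => A x - ev X p x) e.

Definition in_closure A := forall e, 0 < e -> exists p, approx A p e.

Lemma closure_linear A : in_closure A -> linear A.
Proof.
move=> hA a x y; apply/eqP; rewrite -subr_eq0; apply/eqP.
apply: (@vnorm_small _ _ _ (vnorm (a *: x + y) + (complex.Re `|a| * vnorm x + vnorm y))).
  by rewrite !addr_ge0 ?mulr_ge0 ?vnorm_ge0 // Re_normr_ge0.
move=> e /hA[p hp].
have -> : A (a *: x + y) - (a *: A x + A y)
    = (A (a *: x + y) - ev X p (a *: x + y)) - (a *: (A x - ev X p x) + (A y - ev X p y)).
  by rewrite (ev_linear X p) scalerBr addrACA -opprD opprB [RHS]addrA subrK.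
apply: le_trans (vnormB _ _) _; rewrite mulrDr lerD //.
apply: le_trans (vnorm_triangle _ _) _; rewrite mulrDr lerD //.
by rewrite vnormZ mulrCA ler_wpM2l // Re_normr_ge0.
Qed.

Lemma opbound_ev p : exists2 c, 0 <= c & opbound (ev X p) c.
Proof.
have cS_le e x : vnorm (cS X e x) <= vnorm x.
  rewrite -[leRHS]mul1r vnorm_le // expr1n mul1r.
  have := nsq_ge0 (x - cP X (rng e) x); rewrite nsqB.
  have -> : nsq (cP X (rng e) x) = nsq (cS X e x).
    by rewrite /nsq ck_adj ck_AS ck_sa ck_PP.
  by rewrite /nsq ck_adj ck_AS; lra.
have cP_le v x : vnorm (cP X v x) <= vnorm x.
  rewrite -[leRHS]mul1r vnorm_le // expr1n mul1r.
  have := nsq_ge0 (x - cP X v x); rewrite nsqB.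
  have -> : inner H x (cP X v x) = inner H (cP X v x) (cP X v x).
    by rewrite ck_sa ck_PP.
  by rewrite -/(nsq (cP X v x)); lra.
have cA_le e x : vnorm (cA X e x) <= vnorm x.
  set y := cA X e x; have [y0|yn] := eqVneq (vnorm y) 0.
    by rewrite y0 vnorm_ge0.
  have yp : 0 < vnorm y by rewrite lt_neqAle eq_sym yn vnorm_ge0.
  have -> : vnorm y = complex.Re (inner H (cS X e y) x) / vnorm y.
    by rewrite ck_adj -/(nsq y) -vnorm_sq expr2 mulfK.
  rewrite ler_pdivrMr // mulrC; apply: le_trans (cauchy_schwarz _ _) _.
  by rewrite ler_wpM2r ?vnorm_ge0.
have Sw_le s x : vnorm (Sw X s x) <= vnorm x.
  by elim: s => //= e s; exact: le_trans.
have Aw_le s x : vnorm (Aw X s x) <= vnorm x.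
  by elim: s x => //= e s IH x; apply: le_trans (IH _) _.
elim: p => [|a p [c c0 IH]].
  by exists 0 => // x; rewrite ev_nil vnorm0 mul0r.
have a0 := Re_normr_ge0 a.1.
exists (complex.Re `|a.1| + c); first exact: addr_ge0.
move=> x; rewrite /ev big_cons; apply: le_trans (vnorm_triangle _ _) _.
rewrite mulrDl lerD //; last exact: IH.
rewrite vnormZ ler_wpM2l //; apply: le_trans (Sw_le _ _) _.
by apply: le_trans (cP_le _ _) _.
Qed.

Lemma approx_subp A p q (d e : R) :
  approx A p d -> approx A q e -> opbound (ev X (subp p q)) (d + e).
Proof.
move=> hp hq x; rewrite ev_subp (addrC d) mulrDl.
have -> : ev X p x - ev X q x = (A x - ev X q x) - (A x - ev X p x).
  by rewrite opprB [RHS]addrC addrA subrK.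
by apply: le_trans (vnormB _ _) _; apply: lerD.
Qed.

Lemma approx_trans A p q (d e : R) :
  approx A p d -> opbound (ev X (subp p q)) e -> approx A q (d + e).
Proof.
move=> hp hq x; rewrite mulrDl.
have -> : A x - ev X q x = (A x - ev X p x) + ev X (subp p q) x.
  by rewrite ev_subp addrA subrK.
by apply: le_trans (vnorm_triangle _ _) _; apply: lerD.
Qed.

Lemma approx_eq A B : (forall e, 0 < e -> exists p, approx A p e /\ approx B p e) -> A = B.
Proof.
move=> h; apply/funext => x; apply/eqP; rewrite -subr_eq0; apply/eqP.
apply: (@vnorm_small _ _ _ (vnorm x + vnorm x)); first by rewrite addr_ge0 ?vnorm_ge0.
move=> e /h[p [hA hB]].
have -> : A x - B x = (A x - ev X p x) - (B x - ev X p x) by rewrite opprB addrA subrK.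
by apply: le_trans (vnormB _ _) _; rewrite mulrDr lerD.
Qed.

(** The constant 2: in the limit only indices [m >= n] matter, and for them
[inv1 m + inv1 n] is at most [2 * inv1 n]. *)
Lemma limit_approx (f : nat -> seq (term R E)) :
  (forall m n, opbound (ev X (subp (f m) (f n))) (inv1 R m + inv1 R n)) ->
  exists B, forall n, approx B (f n) (2 * inv1 R n).
Proof.
move=> hf.
have h x : exists l, forall e N, 0 < e ->
    exists2 m, (N <= m)%N & vnorm (l - ev X (f m) x) < e.
  by apply: (exists_limit (vnorm_ge0 x)) => m n; rewrite -ev_subp; exact: hf.
have [B hB] := choice h; exists B => n x.
apply: (@ler_small _ _ _ 1) => // e e0; rewrite mulr1.
have [m nm hm] := hB x e n e0.
have -> : B x - ev X (f n) x = (B x - ev X (f m) x) + ev X (subp (f m) (f n)) x.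
  by rewrite ev_subp addrA subrK.
apply: le_trans (vnorm_triangle _ _) _; rewrite addrC lerD ?(ltW hm) //.
apply: le_trans (hf m n x) _; rewrite ler_wpM2r ?vnorm_ge0 //.
by have := inv1_le R nm; lra.
Qed.

Lemma closure_bounded A : in_closure A -> exists2 c, 0 <= c & opbound A c.
Proof.
move=> /(_ 1 ltr01)[p hp]; have [c c0 hc] := opbound_ev p.
exists (1 + c); first by rewrite addr_ge0.
move=> x; rewrite -(subrK (ev X p x) (A x)) mulrDl.
by apply: le_trans (vnorm_triangle _ _) _; apply: lerD.
Qed.

Lemma closure_bounded_operator A : in_closure A -> bounded_operator A.
Proof.
move=> hA; apply/bounded_operatorP; split; first exact: closure_linear.
exact: closure_bounded.
Qed.

End Closure.

(** * The correspondence between two closures *)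

Section Relation.
Variables (R : realType) (E : graph) (H K : hilbert R).
Variables (X : ckrep E H) (Y : ckrep E K).
Hypothesis hE : every_loop_has_exit E.
Implicit Types (p q : seq (term R E)) (A : H -> H) (B : K -> K).

(** The closure of the set of the pairs of values of a formal combination in the
two families: the graph of the isomorphism. *)
Definition corr A B :=
  forall e, 0 < e -> exists p, approx X A p e /\ approx Y B p e.

Lemma corr_closurel A B : corr A B -> in_closure X A.
Proof. by move=> h e /h[p [hA _]]; exists p. Qed.

Lemma corr_closurer A B : corr A B -> in_closure Y B.
Proof. by move=> h e /h[p [_ hB]]; exists p. Qed.

Lemma corr_approx A B p (e d : R) : 0 <= e -> 0 < d ->
  corr A B -> approx X A p e -> approx Y B p (e + d).
Proof.
move=> e0 d0 h hp; have d2 : 0 < d / 2 by rewrite divr_gt0.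
have [q [hA hB]] := h _ d2.
have -> : e + d = d / 2 + (d / 2 + e) by lra.
apply: approx_trans hB _; apply: norm_transfer hE _ (approx_subp hA hp).
by rewrite addr_ge0 // ltW.
Qed.

Lemma corr_unique A B B' : corr A B -> corr A B' -> B = B'.
Proof.
move=> h h'; apply: (@approx_eq _ _ _ Y) => e e0.
have e2 : 0 < e / 2 by rewrite divr_gt0.
have [p [hA hB]] := h _ e2; exists p.
have ee : e / 2 + e / 2 = e by lra.
split; first by apply: opbound_le hB _; lra.
by rewrite -ee; apply: corr_approx h' hA => //; exact: ltW.
Qed.

Lemma approx_seq A B : corr A B ->
  exists f, forall n, approx X A (f n) (inv1 R n) /\ approx Y B (f n) (inv1 R n).
Proof. by move=> h; have [f hf] := choice (fun n => h _ (inv1_gt0 R n)); exists f. Qed.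

Lemma approx_double (e : R) : 0 < e -> exists n, 2 * inv1 R n < e.
Proof. by move=> e0; apply: inv1_small. Qed.

Lemma corr_exists A : in_closure X A -> exists B, corr A B.
Proof.
move=> hA; have [f hf] := choice (fun n => hA _ (inv1_gt0 R n)).
have [|B hB] := @limit_approx _ _ _ Y f.
  move=> m n; apply: (norm_transfer Y hE) (approx_subp (hf m) (hf n)).
  by rewrite addr_ge0 // ltW // inv1_gt0.
exists B => e e0; have [n hn] := approx_double e0; exists (f n); split.
  by apply: opbound_le (hf n) _; have := inv1_gt0 R n; lra.
by apply: opbound_le (hB n) (ltW hn).
Qed.

Lemma corr_ev p : corr (ev X p) (ev Y p).
Proof.
by move=> e e0; exists p; split=> x; rewrite subrr vnorm0 mulr_ge0 ?vnorm_ge0 ?ltW.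
Qed.

Lemma approx_add (L : hilbert R) (Z : ckrep E L) (A1 A2 : L -> L) p1 p2 (d e : R) :
  approx Z A1 p1 d -> approx Z A2 p2 e ->
  approx Z (A1 + A2) (p1 ++ p2) (d + e).
Proof.
move=> h1 h2 x; rewrite ev_cat /= opprD mulrDl.
rewrite -[(A1 + A2) x]/(A1 x + A2 x) addrACA.
by apply: le_trans (vnorm_triangle _ _) _; apply: lerD.
Qed.

Lemma approx_scale (L : hilbert R) (Z : ckrep E L) (A1 : L -> L) (a : R[i]) p1 (d : R) :
  approx Z A1 p1 d -> approx Z (a *: A1) (scalep a p1) (complex.Re `|a| * d).
Proof.
move=> h1 x; rewrite ev_scale -[(a *: A1) x]/(a *: A1 x) -scalerBr vnormZ -mulrA.
by rewrite ler_wpM2l // Re_normr_ge0.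
Qed.

Lemma approx_mul (L : hilbert R) (Z : ckrep E L) (A1 A2 : L -> L) p1 p2 (c1 c2 d e : R) :
  0 <= d -> 0 <= c1 -> opbound A2 c2 -> opbound (ev Z p1) c1 ->
  approx Z A1 p1 d -> approx Z A2 p2 e ->
  approx Z (A1 \o A2) (mulp p1 p2) (d * c2 + c1 * e).
Proof.
move=> d0 c10 b2 b1 h1 h2 x; rewrite ev_mulp /= mulrDl.
have -> : A1 (A2 x) - ev Z p1 (ev Z p2 x)
    = (A1 (A2 x) - ev Z p1 (A2 x)) + ev Z p1 (A2 x - ev Z p2 x).
  by rewrite linearB /= addrA subrK.
apply: le_trans (vnorm_triangle _ _) _; rewrite -!mulrA; apply: lerD.
  by apply: le_trans (h1 _) _; rewrite ler_wpM2l.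
by apply: le_trans (b1 _) _; rewrite ler_wpM2l.
Qed.

Lemma corr_add A1 A2 B1 B2 : corr A1 B1 -> corr A2 B2 -> corr (A1 + A2) (B1 + B2).
Proof.
move=> h1 h2 e e0; have e2 : 0 < e / 2 by rewrite divr_gt0.
have ee : e = e / 2 + e / 2 by lra.
have [p [hA hB]] := h1 _ e2; have [q [hA' hB']] := h2 _ e2.
by exists (p ++ q); rewrite ee; split; apply: approx_add.
Qed.

Lemma corr_scale (a : R[i]) A B : corr A B -> corr (a *: A) (a *: B).
Proof.
move=> h e e0; set r := complex.Re `|a|.
have r0 : 0 <= r := Re_normr_ge0 a.
have r1 : 0 < r + 1 by lra.
have d0 : 0 < e / (r + 1) by rewrite divr_gt0.
have [p [hA hB]] := h _ d0; exists (scalep a p).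
have le : r * (e / (r + 1)) <= e.
  by rewrite mulrCA ger_pMr // ler_pdivrMr // mul1r; lra.
by split; apply: opbound_le le; apply: approx_scale.
Qed.

Lemma corr_mul A1 A2 B1 B2 : corr A1 B1 -> corr A2 B2 -> corr (A1 \o A2) (B1 \o B2).
Proof.
move=> h1 h2 e e0.
have [a a0 ha] := closure_bounded (corr_closurel h2).
have [b b0 hb] := closure_bounded (corr_closurer h2).
have s1 : 0 < 2 * (a + b + 1) by lra.
have d0 : 0 < e / (2 * (a + b + 1)) by rewrite divr_gt0.
have [p [pA pB]] := h1 _ d0.
have [c c0 hc] := opbound_ev X p; have hc' := norm_transfer Y hE c0 hc.
have s2 : 0 < 2 * (c + 1) by lra.
have d0' : 0 < e / (2 * (c + 1)) by rewrite divr_gt0.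
have [q [qA qB]] := h2 _ d0'.
have half (s t : R) : 0 <= t -> t <= s -> 0 < s -> e / (2 * s) * t <= e / 2.
  move=> t0 ts sp; have -> : e / (2 * s) * t = e / 2 * (t / s) by field; lra.
  by rewrite ger_pMr ?divr_gt0 // ler_pdivrMr // mul1r.
have ha' : e / (2 * (a + b + 1)) * a <= e / 2 by apply: half; lra.
have hb' : e / (2 * (a + b + 1)) * b <= e / 2 by apply: half; lra.
have hcc : c * (e / (2 * (c + 1))) <= e / 2 by rewrite mulrC; apply: half; lra.
exists (mulp p q); split.
  by apply: opbound_le (approx_mul (ltW d0) c0 ha hc pA qA) _; lra.
by apply: opbound_le (approx_mul (ltW d0) c0 hb hc' pB qB) _; lra.
Qed.

Lemma approx_adjoint (L : hilbert R) (Z : ckrep E L) (A1 A2 : L -> L)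
    (f : nat -> seq (term R E)) :
  (forall n, approx Z A1 (f n) (inv1 R n)) ->
  (forall n, approx Z A2 (adjp (f n)) (2 * inv1 R n)) -> is_adjoint A1 A2.
Proof.
move=> h1 h2 x y; apply/eqP; rewrite -subr_eq0; apply/eqP.
have c0 : 0 <= vnorm x * vnorm y by rewrite mulr_ge0 ?vnorm_ge0.
apply: (ip_small (c := vnorm x * vnorm y)) => // e e0.
have [n hn] := inv1_small e0 (ler0n R 3).
have -> : inner L (A1 x) y - inner L x (A2 y)
   = inner L (A1 x - ev Z (f n) x) y - inner L x (A2 y - ev Z (adjp (f n)) y).
  by rewrite ipDl ipNl ipDr ipNr ev_adj opprB addrA subrK.
set u := inner L (_ - _) _; set v := inner L x (_ - _).
have le3 : complex.Re `|u - v| <= complex.Re `|u| + complex.Re `|v|.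
  by have := ler_normB u v; rewrite lecE ReD => /andP[_].
apply: le_trans le3 _.
have hu : complex.Re `|u| <= inv1 R n * (vnorm x * vnorm y).
  apply: le_trans (norm_cauchy_schwarz _ _) _.
  by rewrite mulrA ler_wpM2r ?vnorm_ge0 //; exact: h1.
have hv : complex.Re `|v| <= 2 * inv1 R n * (vnorm x * vnorm y).
  apply: le_trans (norm_cauchy_schwarz _ _) _.
  by rewrite [leRHS]mulrCA ler_wpM2l ?vnorm_ge0 //; exact: h2.
apply: le_trans (lerD hu hv) _; rewrite -mulrDl ler_wpM2r //.
by move: hn; lra.
Qed.

(** An approximating sequence p_n of A has p_n* converging as well, in the norm,
and its limit is the adjoint of A. *)
Lemma corr_adjoint A B : corr A B ->
  exists A' B', [/\ is_adjoint A A', is_adjoint B B' & corr A' B'].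
Proof.
move=> h; have [f hf] := approx_seq h.
have adj_bound (L : hilbert R) (Z : ckrep E L) (D : L -> L) :
    (forall n, approx Z D (f n) (inv1 R n)) ->
    exists D', forall n, approx Z D' (adjp (f n)) (2 * inv1 R n).
  move=> hD; apply: (@limit_approx _ _ _ Z (fun n => adjp (f n))) => m n x.
  rewrite ev_subp -ev_adjp_subp; apply: opbound_adjp.
    by rewrite addr_ge0 // ltW // inv1_gt0.
  exact: approx_subp (hD m) (hD n).
have hX n := (hf n).1; have hY n := (hf n).2.
have [A' hA'] := adj_bound _ _ _ hX; have [B' hB'] := adj_bound _ _ _ hY.
exists A', B'; split; [exact: approx_adjoint hX hA'|exact: approx_adjoint hY hB'|].
move=> e e0; have [n hn] := approx_double e0; exists (adjp (f n)).
by split; [apply: opbound_le (hA' n) (ltW hn)|apply: opbound_le (hB' n) (ltW hn)].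
Qed.

End Relation.

(** * The generated algebra is the closure *)

Section Generated.
Variables (R : realType) (E : graph) (H : hilbert R) (Z : ckrep E H).
Hypothesis hE : every_loop_has_exit E.

Lemma closure_corr A : in_closure Z A -> corr Z Z A A.
Proof. by move=> h e /h[p hp]; exists p. Qed.

Lemma closure_adjoint A : in_closure Z A ->
  is_adjoint A (adjoint A) /\ in_closure Z (adjoint A).
Proof.
move=> /closure_corr/(corr_adjoint)[A' [_ [hA' _ /corr_closurel h]]].
by rewrite (adjointE hA').
Qed.

Lemma closure_cstar : is_cstar_subalgebra (in_closure Z).
Proof.
split.
- exact: closure_bounded_operator.
- by move=> e e0; exists [::] => x; rewrite ev_nil subr0 vnorm0 mulr_ge0 ?vnorm_ge0 ?ltW.
- by move=> T1 T2 /closure_corr h1 /closure_corr h2; exact: corr_closurel (corr_add h1 h2).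
- by move=> a T /closure_corr h; exact: corr_closurel (corr_scale a h).
- by move=> T1 T2 /closure_corr h1 /closure_corr h2; exact: corr_closurel (corr_mul hE h1 h2).
- by move=> T /closure_adjoint[].
- move=> T bT hT e e0; have e2 : 0 < e / 2 by rewrite divr_gt0.
  have [T' hT' hlt] := hT _ e2; have [p hp] := hT' _ e2; exists p => x.
  have bTT : bounded_operator (T - T').
    have [lT [M M0 hM]] := (bounded_operatorP T).1 bT.
    have [lT' [M' M0' hM']] := (bounded_operatorP T').1 (closure_bounded_operator hT').
    apply/bounded_operatorP; split.
      move=> a u v; rewrite -[(T - T') _]/(T _ - T' _) lT lT' opprD addrACA.
      by rewrite -scalerBr.
    exists (M + M'); rewrite ?addr_ge0 // => u; rewrite mulrDl.
    by apply: le_trans (vnormB _ _) _; apply: lerD.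
  have [M /andP[M0 Me] hM] := opnorm_lt bTT hlt.
  have -> : T x - ev Z p x = (T - T') x + (T' x - ev Z p x).
    by rewrite -[(T - T') x]/(T x - T' x) addrA subrK.
  apply: le_trans (vnorm_triangle _ _) _.
  have -> : e * vnorm x = e / 2 * vnorm x + e / 2 * vnorm x by lra.
  apply: lerD; last exact: hp.
  exact: (opbound_le hM (ltW Me)).
Qed.

Definition edge_term e : seq (term R E) := [:: (1, ([:: e], rng e, [::]))].
Definition vertex_term v : seq (term R E) := [:: (1, ([::], v, [::]))].

Lemma ev_edge e : ev Z (edge_term e) = cS Z e.
Proof.
by apply/funext => x; rewrite /ev big_seq1 scale1r /evm /= ck_SP.
Qed.

Lemma ev_vertex v : ev Z (vertex_term v) = cP Z v.
Proof. by apply/funext => x; rewrite /ev big_seq1 scale1r. Qed.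

Lemma closure_ev p : in_closure Z (ev Z p).
Proof. exact: corr_closurel (corr_ev Z Z p). Qed.

Lemma adjoint_cS e : adjoint (cS Z e) = cA Z e.
Proof. by apply: adjointE => x y; exact: ck_adj. Qed.

Lemma ev_in_subalgebra (A : set (H -> H)) p : is_cstar_subalgebra A ->
  (forall e, A (cS Z e)) -> (forall v, A (cP Z v)) -> A (ev Z p).
Proof.
move=> hA hS hP.
have hAd e : A (cA Z e) by rewrite -adjoint_cS; exact: cstar_adjoint.
have hSw s B : A B -> A (fun x => Sw Z s (B x)).
  by move=> hB; elim: s => //= e s IH; exact: (cstar_mul hA (hS e) IH).
have hAw s B : A B -> A (fun x => B (Aw Z s x)).
  elim: s B => //= e s IH B hB.
  exact: (cstar_mul hA (IH B hB) (hAd e)).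
elim: p => [|a p IH].
  have -> : ev Z [::] = 0 by apply/funext => x; rewrite ev_nil.
  exact: cstar_zero.
have -> : ev Z (a :: p) = a.1 *: evm Z a.2 + ev Z p.
  by apply/funext => x; rewrite /ev big_cons.
apply: (cstar_add hA) IH; apply: (cstar_scale hA); apply: hSw.
exact: (hAw _ (cP Z a.2.1.2)).
Qed.

Lemma CK_algebraE (S : edge E -> H -> H) (P : vertex E -> H -> H) :
  (forall e, cS Z e = S e :> (H -> H)) -> (forall v, cP Z v = P v :> (H -> H)) ->
  CK_algebra S P = in_closure Z.
Proof.
move=> hS hP; apply/seteqP; split=> [T|T hT A [hA sub]].
  apply; split; first exact: closure_cstar.
  move=> _ [[e _ <-]|[v _ <-]]; first by rewrite -hS -ev_edge; exact: closure_ev.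
  by rewrite -hP -ev_vertex; exact: closure_ev.
apply: (cstar_closed hA); first exact: closure_bounded_operator hT.
move=> e e0; have e2 : 0 < e / 2 by rewrite divr_gt0.
have [p hp] := hT _ e2; exists (ev Z p).
  apply: ev_in_subalgebra => // [f|v]; apply: sub; [left|right].
    by rewrite hS; exists f.
  by rewrite hP; exists v.
apply: le_lt_trans (_ : e / 2 < e); last by lra.
by apply: opnorm_le; [exact: ltW|exact: hp].
Qed.

End Generated.

(** * The isomorphism *)

Lemma corr_sym (R : realType) (E : graph) (H K : hilbert R) (X : ckrep E H) (Y : ckrep E K) A B :
  corr X Y A B -> corr Y X B A.
Proof. by move=> h e /h[p [h1 h2]]; exists p. Qed.

Section Isomorphism.
Variables (R : realType) (E : graph) (H K : hilbert R).
Variables (X : ckrep E H) (Y : ckrep E K).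
Hypothesis hE : every_loop_has_exit E.

Definition transfer (A : H -> H) : K -> K := xget 0 [set B | corr X Y A B]%classic.

Lemma transferE A B : corr X Y A B -> transfer A = B.
Proof.
move=> h; rewrite /transfer; case: xgetP => [B' _ /= h'|/(_ B)//].
exact (corr_unique hE h' h).
Qed.

Lemma transferP A : in_closure X A -> corr X Y A (transfer A).
Proof. by move=> /(corr_exists Y hE)[B h]; rewrite (transferE h). Qed.

Lemma transfer_isomorphism :
  is_cstar_isomorphism (in_closure X) (in_closure Y) transfer.
Proof.
split.
- split=> [A hA|A A' /set_mem hA /set_mem hA' e|B hB].
  + exact: corr_closurer (transferP hA).
  + apply: (corr_unique hE (corr_sym (transferP hA))).
    by rewrite e; exact: corr_sym (transferP hA').
  + have [A hA] := corr_exists X hE hB; have h := corr_sym hA.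
    by exists A; [exact: corr_closurel h|exact: transferE].
- move=> A A' /transferP h /transferP h'; exact/transferE/corr_add.
- move=> a A /transferP h; exact/transferE/corr_scale.
- move=> A A' /transferP h /transferP h'; exact/transferE/corr_mul.
- move=> A /transferP h; have [A' [B' [hA hB h']]] := corr_adjoint h.
  by rewrite (adjointE hA) (adjointE hB) (transferE h').
Qed.

End Isomorphism.

Theorem corollary2p12 (R : realType) (E : graph) (H K : hilbert R)
    (S : edge E -> H -> H) (P : vertex E -> H -> H)
    (T : edge E -> K -> K) (Q : vertex E -> K -> K) :
  every_loop_has_exit E ->
  is_CK_family S P ->
  is_CK_family T Q ->
  (forall v : vertex E, P v <> 0) ->
  (forall v : vertex E, Q v <> 0) ->
  exists phi : (H -> H) -> (K -> K),
    [/\ is_cstar_isomorphism (CK_algebra S P) (CK_algebra T Q) phi,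
        forall e : edge E, phi (S e) = T e
      & forall v : vertex E, phi (P v) = Q v].
Proof.
move=> hE hSP hTQ P0 Q0.
have [X [XS XP]] := CK_rep hSP P0; have [Y [YT YQ]] := CK_rep hTQ Q0.
rewrite (CK_algebraE hE XS XP) (CK_algebraE hE YT YQ).
exists (transfer X Y); split=> [|e|v]; first exact: transfer_isomorphism.
- rewrite -XS -YT -!ev_edge; exact/transferE/corr_ev.
- rewrite -XP -YQ -!ev_vertex; exact/transferE/corr_ev.
Qed.
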